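(* Let $d\ge 1$, let $0<r\le R$, and let $\omega\subset\mathbb{R}^d$ be an $(r,R)$-Delone set with finite local complexity and uniform cluster frequencies. If $\omega$ is pure point diffractive, then its patch counting entropy satisfies $h_{\rm pc}(\omega)=0$.
   Context: $B_S(x)$ is the closed Euclidean ball of radius $S$ around $x\in\mathbb{R}^d$, $B_S=B_S(0)$, and $|\cdot|$ is Lebesgue volume. Delone sets: a subset $\omega\subset\mathbb{R}^d$ is an $(r,R)$-Delone set if every open ball of radius $r$ contains at most one point of $\omega$ and every closed ball of radius $R$ contains at least one point of $\omega$. Patches: for $D>0$, the set of $D$-patches of $\omega$ is $p_\omega(D)=\{(-x+\omega)\cap B_D : x\in\omega\}$. The set $\omega$ has finite local complexity (FLC) if $\operatorname{card}(p_\omega(D))<\infty$ for every $D>0$. Uniform cluster frequencies: a cluster of $\omega$ is a non-empty set of the form $P=(-y+\omega)\cap K$ with $K\subset\mathbb{R}^d$ compact and $y\in\omega$. The set $\omega$ has uniform cluster frequencies if, for every such $K$ and $P$, the limit $\lim_{n\to\infty}\frac{1}{|B_n|}\operatorname{card}\{x\in a_n+B_n : (-x+\omega)\cap K=P\}$ exists and is independent of the sequence $(a_n)\subset\mathbb{R}^d$. Diffraction: for $\omega$ with FLC and uniform cluster frequencies, the autocorrelation $\gamma_\omega=\lim_{n\to\infty}\frac{1}{|B_n|}\sum_{x,y\in\omega\cap B_n}\delta_{x-y}$ exists as a limit in the vague topology, where $\delta_z$ is the unit point mass at $z$. It is a positive definite measure, so its Fourier transform $\widehat{\gamma_\omega}$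 exists and is a positive measure. The set $\omega$ is pure point diffractive if $\widehat{\gamma_\omega}$ is a pure point measure. Patch counting entropy: $h_{\rm pc}(\omega)=\limsup_{n\to\infty}\frac{1}{|B_n|}\log\bigl(\operatorname{card}(p_\omega(n))\bigr)$. *)

(* Defs.v *)
From HB Require Import structures.
From mathcomp Require Import all_boot all_order all_algebra finmap.
From mathcomp Require Import all_classical all_reals all_analysis.
From mathcomp Require Import measurable_realfun complex.
Import Order.TTheory GRing.Theory Num.Theory.
Import numFieldNormedType.Exports.

Set Implicit Arguments.
Unset Strict Implicit.
Unset Printing Implicit Defensive.

Local Open Scope classical_set_scope.
Local Open Scope ring_scope.

Fact borel_display : measure_display.
Proof. exact: default_measure_display. Qed.

Section borel_rV.
Variables (R : realType) (d : nat).

Definition borel_rV : set (set 'rV[R]_d) := <<s @open 'rV[R]_d >>.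

Let borel0 : borel_rV set0.
Proof. exact: sigma_algebra0. Qed.

Let borelC A : borel_rV A -> borel_rV (~` A).
Proof. exact: sigma_algebraC. Qed.

Let borelU (F : (set 'rV[R]_d)^nat) :
  (forall i, borel_rV (F i)) -> borel_rV (\bigcup_i F i).
Proof. exact: sigma_algebra_bigcup. Qed.

HB.instance Definition _ := @isMeasurable.Build borel_display 'rV[R]_d
  borel_rV borel0 borelC borelU.

End borel_rV.

(* A map into R^d is Borel as soon as its coordinates are: every open set is a
   countable union of open cubes with rational centers and radii 1/(k+1). *)
Lemma measurable_fun_rV (R : realType) (d : nat) (dT : measure_display)
    (T : measurableType dT) (f : T -> 'rV[R]_d) :
  (forall i, measurable_fun setT (fun t => f t ord0 i)) ->
  measurable_fun setT f.
Proof.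
move=> mf.
pose cube (qk : 'rV[rat]_d * nat) : set 'rV[R]_d :=
  [set x | forall i, `|ratr (qk.1 ord0 i) - x ord0 i| < qk.2.+1%:R^-1].
apply: (@measurability _ _ _ _ setT f (@open 'rV[R]_d)) => //.
move=> _ [U oU <-]; rewrite setTI.
have -> : U = \bigcup_(qk in [set qk | cube qk `<=` U]) cube qk.
  apply/seteqP; split => [x Ux|x [qk /= sU]]; last exact: sU.
  have /nbhs_ballP[e /= e0 eU] : nbhs x U by exact: open_nbhs_nbhs.
  have [k kU] : exists k : nat, (k.+1%:R^-1 : R) < e / 2.
    have := near_infty_natSinv_lt (PosNum (divr_gt0 e0 (ltr0n R 2))).
    by case=> k _ /(_ k (leqnn _)) /= kU; exists k.
  have qx i : exists q : rat, `|ratr q - x ord0 i| < k.+1%:R^-1 :> R.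
    have [q] : exists q : rat, ratr q \in
        `]x ord0 i - k.+1%:R^-1, x ord0 i + k.+1%:R^-1[%R.
      apply: rat_in_itvoo.
      by rewrite ltrBlDr -addrA ltrDl addr_gt0 // invr_gt0 ltr0n.
    by rewrite in_itv/= -ltr_distl => ?; exists q.
  have [q qP] := choice qx.
  exists (\row_i q i, k) => /=; last by move=> i; rewrite mxE.
  move=> y /= qy; apply: eU; split=> // i j; rewrite (ord1 i) /ball /=.
  rewrite -(subrKA (ratr (q j))) (le_lt_trans (ler_normD _ _))//.
  rewrite (splitr e) ltrD//; first by rewrite distrC (lt_trans (qP _)).
  by have := qy j; rewrite mxE => /lt_trans; apply.
rewrite preimage_bigcup bigcup_mkcond.
apply: countable_bigcupT_measurable => // qk.
case: ifP => // _.
have -> : f @^-1` cube qk = \bigcap_(i in [set: 'I_d])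
    ((fun t => f t ord0 i) @^-1`
      [set y | `|ratr (qk.1 ord0 i) - y| < qk.2.+1%:R^-1]).
  by apply/seteqP; split => [t ft i _|t ft i]; [exact: ft|exact: (ft i I)].
apply: fin_bigcap_measurable => // i _.
rewrite -[X in measurable X]setTI; apply: mf => //.
rewrite (_ : [set _ | _] = ball (ratr (qk.1 ord0 i) : R) qk.2.+1%:R^-1) //.
apply: open_measurable; exact: ball_open.
Qed.

Section lebesgue_rV.
Variable R : realType.

Definition row_cons n (p : 'rV[R]_n * measurableTypeR R) : 'rV[R]_n.+1 :=
  row_mx (p.2%:M : 'rV[R]_1) p.1.

Lemma measurable_coord n (i : 'I_n) :
  measurable_fun setT (fun x : 'rV[R]_n => x ord0 i).
Proof.
apply: (measurability _ (RGenOpens.measurableE R)).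
move=> _ [_ [a [b ->] <-]]; rewrite setTI; apply: sub_sigma_algebra.
by apply: open_comp; [move=> x _; exact: coord_continuous|exact: interval_open].
Qed.

Lemma measurable_row_cons n : measurable_fun setT (@row_cons n).
Proof.
apply: measurable_fun_rV => i; rewrite -(@fintype.splitK 1 n i) /row_cons.
case: (@fintype.split 1 n i) => j /=.
  under eq_fun do rewrite (row_mxEl (_ : 'rV[R]_1)) (ord1 j) mxE eqxx mulr1n.
  exact: measurable_snd.
under eq_fun do rewrite (row_mxEr (_ : 'rV[R]_1)).
exact: (measurableT_comp (measurable_coord j) measurable_fst).
Qed.

Section step.
Variables (n : nat) (mu : {measure set 'rV[R]_n -> \bar R}).

Definition lebesgue_step : set 'rV[R]_n.+1 -> \bar R :=
  pushforward (mu \x @lebesgue_measure R)%E (@row_cons n).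

Let step0 : lebesgue_step set0 = 0%E.
Proof. by rewrite /lebesgue_step /pushforward preimage_set0 measure0. Qed.

Let step_ge0 A : (0 <= lebesgue_step A)%E.
Proof. exact: (@measure_ge0 _ _ _ (mu \x @lebesgue_measure R)%E). Qed.

Let step_sigma_additive : semi_sigma_additive lebesgue_step.
Proof.
have mc := @measurable_row_cons n.
exact: measure_semi_sigma_additive.
Qed.

HB.instance Definition _ := isMeasure.Build _ _ _ lebesgue_step
  step0 step_ge0 step_sigma_additive.

End step.

(* d-dimensional Lebesgue measure, as the d-fold product of the Lebesgue measure
   on R, transported to row vectors. *)
Fixpoint lebesgue_rV n : {measure set 'rV[R]_n -> \bar R} :=
  match n with
  | 0 => dirac (0 : 'rV[R]_0)
  | m.+1 => lebesgue_step (lebesgue_rV m)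
  end.

Lemma lebesgue_rV_box n (A : 'I_n -> set R) : (forall i, measurable (A i)) ->
  lebesgue_rV n [set x : 'rV[R]_n | forall i, A i (x ord0 i)] =
  (\prod_(i < n) lebesgue_measure (A i))%E.
Proof.
have mbox m (B : 'I_m -> set R) : (forall i, measurable (B i)) ->
    measurable [set x : 'rV[R]_m | forall i, B i (x ord0 i)].
  move=> mB.
  have -> : [set x : 'rV[R]_m | forall i, B i (x ord0 i)] =
      \bigcap_(i in [set: 'I_m]) ((fun x => x ord0 i) @^-1` B i).
    by apply/seteqP; split => [x Bx i _|x Bx i]; [exact: Bx|exact: (Bx i I)].
  apply: fin_bigcap_measurable => // i _.
  by rewrite -[X in measurable X]setTI; exact: measurable_coord.
elim: n A => [|n IH] A mA.
  by rewrite big_ord0 /= diracE mem_set// => -[].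
rewrite big_ord_recl muleC -IH; last by move=> i; exact: mA.
rewrite [LHS]/= /lebesgue_step /pushforward.
rewrite -(product_measure1E (lebesgue_rV n) (@lebesgue_measure R)
  (mbox _ _ (fun i => mA (lift ord0 i))) (mA ord0)).
congr (product_measure1 _ _ _); apply/seteqP; split => -[v x] /=.
  move=> Avx; split=> [i|].
    have := Avx (rshift 1 i).
    by rewrite /row_cons (row_mxEr (_ : 'rV[R]_1)) /= rshift1.
  have := Avx (lshift n (ord0 : 'I_1)).
  rewrite /row_cons (row_mxEl (_ : 'rV[R]_1)) mxE /= mulr1n.
  by rewrite (_ : lshift _ _ = ord0 :> 'I_(1 + n))//; exact: val_inj.
move=> [Av Ax] i; case: (unliftP ord0 i) => [j|] ->.
  by rewrite -rshift1 /row_cons (row_mxEr (_ : 'rV[R]_1)) /= rshift1.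
have -> : ord0 = lshift n (ord0 : 'I_1) :> 'I_(1 + n) by exact: val_inj.
rewrite /row_cons (row_mxEl (_ : 'rV[R]_1)) mxE /= mulr1n.
by rewrite (_ : lshift _ _ = ord0 :> 'I_(1 + n))//; exact: val_inj.
Qed.

End lebesgue_rV.

Section euclidean.
Variables (R : realType) (d : nat).
Implicit Types (x c : 'rV[R]_d) (r : R).

(* The library norm on row vectors is the sup norm; it induces the same
   topology. *)
Definition dotp x c : R := \sum_(i < d) x ord0 i * c ord0 i.
Definition enorm x : R := Num.sqrt (dotp x x).
Definition oball c r : set 'rV[R]_d := [set x | enorm (x - c) < r].
Definition cball c r : set 'rV[R]_d := [set x | enorm (x - c) <= r].

Definition vol (A : set 'rV[R]_d) : R := fine (lebesgue_rV R d A).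

End euclidean.

(* Number of elements of a finite set; 0 if the set is infinite. *)
Definition ncard (T : choiceType) (A : set T) : nat := #|` fset_set A|%fset.

Section point_sets.
Variables (R : realType) (d : nat).
Implicit Types (w K P : set 'rV[R]_d).

Definition delone (r rho : R) w : Prop :=
  (forall c, is_subset1 (w `&` oball c r)) /\
  (forall c, w `&` cball c rho !=set0).

Definition recenter (x : 'rV[R]_d) w : set 'rV[R]_d := [set - x + y | y in w].

Definition patches w (D : R) : set (set 'rV[R]_d) :=
  [set recenter x w `&` cball 0 D | x in w].

Definition flc w : Prop := forall D : R, 0 < D -> finite_set (patches w D).

(* [P] is a cluster exactly when it is nonempty and of the form
   [recenter y w `&` K] with [y] in [w]. The counted points [x] need not lie in
   [w] when 0 is not in [K]; there are still finitely many of them, because [P]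
   is nonempty. *)
Definition uniform_cluster_frequencies w : Prop :=
  forall K P, compact K -> P !=set0 ->
    (exists2 y, w y & P = recenter y w `&` K) ->
  exists l : R, forall a : nat -> 'rV[R]_d,
    (vol (cball (0 : 'rV[R]_d) n%:R))^-1 *
      (ncard [set x : 'rV[R]_d | cball (a n) n%:R x /\ recenter x w `&` K = P])%:R
    @[n --> \oo] --> l.

Definition patch_counting_entropy w : \bar R :=
  limn_esup (fun n : nat =>
    ((vol (cball (0 : 'rV[R]_d) n%:R))^-1 *
     ln (ncard (patches w n%:R))%:R)%:E).

End point_sets.

Section diffraction.
Variables (R : realType) (d : nat).
Local Open Scope complex_scope.
Local Notation E := 'rV[R]_d.
Local Notation C := (complex R).
Implicit Types (mu gamma : {measure set E -> \bar R}) (f g : E -> C).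

Definition compactly_supported (V : zmodType) (f : E -> V) : Prop :=
  compact (closure [set x | f x != 0]).

Definition locally_finite mu : Prop :=
  forall K : set E, compact K -> (mu K < +oo)%E.

(* Testing the vague limit on real-valued functions is enough, since all the
   measures involved are real. *)
Definition is_autocorrelation (w : set E) gamma : Prop :=
  locally_finite gamma /\
  forall phi : E -> R, continuous phi -> compactly_supported phi ->
    (vol (cball (0 : E) n%:R))^-1 *
      \sum_(x \in w `&` cball 0 n%:R) \sum_(y \in w `&` cball 0 n%:R)
        phi (x - y)
    @[n --> \oo] --> \int[gamma]_x phi x.

Definition cintegral mu f : C :=
  (\int[mu]_x complex.Re (f x)) +i* (\int[mu]_x complex.Im (f x)).

Definition sqnormc (z : C) : R := complex.Re z ^+ 2 + complex.Im z ^+ 2.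

Definition expi (t : R) : C := cos t +i* sin t.

Definition inv_fourier f (k : E) : C :=
  cintegral (lebesgue_rV R d) (fun x => f x * expi (2 * pi * dotp k x)).

Definition convolution f g (x : E) : C :=
  cintegral (lebesgue_rV R d) (fun y => f y * g (x - y)).

Definition involution f (x : E) : C := (f (- x))^*.

Definition Cc f : Prop :=
  [/\ continuous (fun x => complex.Re (f x)), continuous (fun x => complex.Im (f x))
    & compactly_supported f].

(* Fourier transform of a measure, as for positive definite measures on locally
   compact abelian groups: the locally finite positive measure [nu] with
   gamma (f * f~) = nu (|f^|^2) for all compactly supported continuous f,
   where f^ is the inverse Fourier transform of f. *)
Definition is_fourier_transform gamma nu : Prop :=
  locally_finite nu /\
  forall f, Cc f ->
    nu.-integrable setT (fun k => (sqnormc (inv_fourier f k))%:E) /\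
    cintegral gamma (convolution f (involution f)) =
      (\int[nu]_k sqnormc (inv_fourier f k))%:C.

Definition pure_point mu : Prop :=
  forall A : set E, measurable A -> mu A = (\esum_(x in A) mu [set x])%E.

(* [gamma] and [nu] are uniquely determined, so this says that the Fourier
   transform of the autocorrelation of [w] is pure point. *)
Definition pure_point_diffractive (w : set E) : Prop :=
  exists gamma nu, [/\ is_autocorrelation w gamma,
    is_fourier_transform gamma nu & pure_point nu].

End diffraction.

(* Main.v *)
(**
  Test the diffraction against the difference f = F - F(. - t) of two bumps:
  |f^|^2 = (2 - 2 cos (2 pi k.t)) |F^|^2 is small in nu-mean as soon as t is an
  almost period of finitely many characters that carry most of the pure point
  measure |F^|^2 nu, and by Dirichlet's theorem such a t exists among the
  multiples p v of any given v. On the other hand, gamma (f * f~) is, up to a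
  positive factor, at least the density of the points x of w without a point of
  w near x + t or near x - t. By uniform cluster frequencies, these unmatched
  points are then rare in every large ball, whatever its center.

  Hence a patch of radius n is determined by the position, up to a fixed grid, of
  its unmatched points and of its points in a slab |x_i| <= n/q orthogonal to t.
  Going outwards, a matched point outside of the slab is near y + t or y - t for
  some y closer to the origin, and finite local complexity turns an approximate
  position relative to an already known neighbour into an exact one. Such data
  are subsets with few elements of a grid with O(n^d) cells, so that there are
  only exp(o(n^d)) of them.
*)

From HB Require Import structures.
Require Import Defs.
From mathcomp Require Import all_boot all_order all_algebra finmap.
From mathcomp Require Import all_classical all_reals all_analysis.
From mathcomp Require Import measurable_realfun complex ring lra zify.
Import Order.TTheory GRing.Theory Num.Theory numFieldNormedType.Exports.

Set Implicit Arguments.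
Unset Strict Implicit.
Unset Printing Implicit Defensive.

Local Open Scope classical_set_scope.
Local Open Scope ring_scope.

(** * Euclidean geometry of row vectors *)

Section euclidean_norm.
Context {R : realType} {d : nat}.
Implicit Types (x y z : 'rV[R]_d) (a : R).

Lemma dotpC x y : dotp x y = dotp y x.
Proof. by apply: eq_bigr => i _; rewrite mulrC. Qed.

Lemma dotpDl x y z : dotp (x + y) z = dotp x z + dotp y z.
Proof. by rewrite -big_split; apply: eq_bigr => i _; rewrite mxE mulrDl. Qed.

Lemma dotpZl a x y : dotp (a *: x) y = a * dotp x y.
Proof. by rewrite mulr_sumr; apply: eq_bigr => i _; rewrite mxE mulrA. Qed.

Lemma dotpDr x y z : dotp x (y + z) = dotp x y + dotp x z.
Proof. by rewrite dotpC dotpDl !(dotpC x). Qed.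

Lemma dotpZr a x y : dotp x (a *: y) = a * dotp x y.
Proof. by rewrite dotpC dotpZl dotpC. Qed.

Lemma dotpNl x y : dotp (- x) y = - dotp x y.
Proof. by rewrite -scaleN1r dotpZl mulN1r. Qed.

Lemma dotpNr x y : dotp x (- y) = - dotp x y.
Proof. by rewrite dotpC dotpNl dotpC. Qed.

Lemma dotp_ge0 x : 0 <= dotp x x.
Proof. by apply: sumr_ge0 => i _; rewrite -expr2 sqr_ge0. Qed.

Lemma enorm_ge0 x : 0 <= enorm x.
Proof. exact: sqrtr_ge0. Qed.

Lemma sqr_enorm x : enorm x ^+ 2 = dotp x x.
Proof. by rewrite sqr_sqrtr ?dotp_ge0. Qed.

Lemma coord_le_enorm x i : `|x ord0 i| <= enorm x.
Proof.
rewrite -sqrtr_sqr ler_wsqrtr// /dotp (bigD1 i)//= -expr2 lerDl.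
by apply: sumr_ge0 => j _; rewrite -expr2 sqr_ge0.
Qed.

Lemma enorm_eq0 x : enorm x = 0 -> x = 0.
Proof.
move=> x0; apply/rowP => i; apply/eqP; rewrite mxE -normr_le0 -x0.
exact: coord_le_enorm.
Qed.

Lemma enormZ a x : enorm (a *: x) = `|a| * enorm x.
Proof.
by rewrite /enorm dotpZl dotpZr mulrA -expr2 sqrtrM ?sqr_ge0// sqrtr_sqr.
Qed.

Lemma enorm0 : enorm (0 : 'rV[R]_d) = 0.
Proof. by rewrite -(scale0r 0) enormZ normr0 mul0r. Qed.

Lemma enormN x : enorm (- x) = enorm x.
Proof. by rewrite -scaleN1r enormZ normrN1 mul1r. Qed.

Lemma enormB x y : enorm (x - y) = enorm (y - x).
Proof. by rewrite -enormN opprB. Qed.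

Lemma dotp_le_enorm x y : dotp x y <= enorm x * enorm y.
Proof.
have [/enorm_eq0 ->|x0] := eqVneq (enorm x) 0.
  by rewrite enorm0 mul0r /dotp big1// => i _; rewrite mxE mul0r.
have [/enorm_eq0 ->|y0] := eqVneq (enorm y) 0.
  by rewrite enorm0 mulr0 /dotp big1// => i _; rewrite mxE mulr0.
have {}x0 : 0 < enorm x by rewrite lt_def x0 enorm_ge0.
have {}y0 : 0 < enorm y by rewrite lt_def y0 enorm_ge0.
have := dotp_ge0 (enorm y *: x - enorm x *: y).
rewrite !(dotpDl, dotpDr, dotpNl, dotpNr, dotpZl, dotpZr) -!sqr_enorm (dotpC y x).
move=> h; rewrite -subr_ge0 -(pmulr_rge0 _ (mulr_gt0 x0 y0)) mulrBr.
by nra.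
Qed.

Lemma ler_enormD x y : enorm (x + y) <= enorm x + enorm y.
Proof.
rewrite -(@ler_pXn2r _ 2)// ?nnegrE ?addr_ge0 ?enorm_ge0//.
rewrite sqr_enorm dotpDl !dotpDr -!sqr_enorm (dotpC y x).
by have := dotp_le_enorm x y; nra.
Qed.

Lemma ler_enormB x y : enorm (x - y) <= enorm x + enorm y.
Proof. by rewrite (le_trans (ler_enormD _ _))// enormN. Qed.

Lemma ler_enorm_sub x y : enorm x - enorm y <= enorm (x - y).
Proof. by rewrite lerBlDr (le_trans _ (ler_enormD _ _))// subrK. Qed.

Lemma ler_enorm_dist y x z : enorm (x - z) <= enorm (x - y) + enorm (y - z).
Proof. by rewrite (le_trans _ (ler_enormD _ _))// addrA subrK. Qed.

Lemma ler_dist_enorm x y : `|enorm x - enorm y| <= enorm (x - y).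
Proof.
by rewrite ler_norml lerNl opprB ler_enorm_sub andbT enormB ler_enorm_sub.
Qed.

Lemma enorm_le x a : 0 <= a -> (forall i, `|x ord0 i| <= a) ->
  enorm x <= d%:R * a.
Proof.
move=> a0 xa; rewrite -(@ler_pXn2r _ 2)// ?nnegrE ?mulr_ge0 ?enorm_ge0//.
rewrite sqr_enorm; apply: (@le_trans _ _ (\sum_(i < d) a ^+ 2)).
  apply: ler_sum => i _; rewrite -expr2 -real_normK ?num_real//.
  by rewrite ler_pXn2r ?nnegrE.
rewrite sumr_const card_ord -[leLHS]mulr_natl exprMn ler_wpM2r ?sqr_ge0//.
by rewrite -natrX ler_nat; case: (d) => // n; rewrite expnS expn1 leq_pmull.
Qed.

Lemma coord_le_norm x i : `|x ord0 i| <= `|x|.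
Proof.
by rewrite [leRHS]/Num.norm /= mx_normrE; apply/bigmax_geP; right => /=; exists (ord0, i).
Qed.

Lemma enorm_le_norm x : enorm x <= d%:R * `|x|.
Proof. by apply: enorm_le => // i; exact: coord_le_norm. Qed.

Lemma norm_le_enorm x : `|x| <= enorm x.
Proof.
rewrite [leLHS]/Num.norm /= mx_normrE; apply/bigmax_leP; split=> [|[i j] _ /=].
  exact: enorm_ge0.
by rewrite (ord1 i) coord_le_enorm.
Qed.

(* The topology is that of the sup norm, which is equivalent to [enorm]. *)
Lemma lipschitz_continuous (f : 'rV[R]_d -> R) (k : R) :
  (forall x y, `|f x - f y| <= k * enorm (x - y)) -> continuous f.
Proof.
move=> fk x; apply/(@cvgrPdist_le _ _ _ (nbhs x)) => e e0.
have [k1 k1k k10] : exists2 k1 : R, k <= k1 & 0 < k1.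
  by exists (Num.max k 1); rewrite ?le_max ?lexx// lt_max ltr01 orbT.
have d1 : 0 < d.+1%:R :> R by rewrite ltr0n.
have e1 : 0 < d.+1%:R^-1 * (k1^-1 * e) by rewrite !mulr_gt0 ?invr_gt0.
apply: filterS (nbhsx_ballx x _ e1) => y; rewrite -ball_normE /= => xy.
rewrite (le_trans (fk _ _))// (le_trans (ler_wpM2r (enorm_ge0 _) k1k))//.
rewrite -ler_pdivlMl// (le_trans (enorm_le_norm _))//.
rewrite (@le_trans _ _ (d.+1%:R * `|x - y|))// ?ler_wpM2r ?ler_nat//.
by rewrite -ler_pdivlMl// ltW.
Qed.

Lemma continuous_dotp y : continuous (fun x => dotp x y).
Proof.
apply: (@lipschitz_continuous _ (enorm y)) => x z.
rewrite -dotpNl -dotpDl mulrC ler_norml dotp_le_enorm andbT.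
by rewrite lerNl -dotpNl -(enormN (x - z)) dotp_le_enorm.
Qed.

Lemma continuous_dotpr x : continuous (dotp x).
Proof.
have -> : dotp x = fun y => dotp y x by apply/funext => y; exact: dotpC.
exact: continuous_dotp.
Qed.

Lemma closed_cball (c : 'rV[R]_d) a : closed (cball c a).
Proof.
have -> : cball c a = (fun x => enorm (x - c)) @^-1` [set t | t <= a] by [].
apply: closed_comp => [x _|]; last exact: closed_le.
apply: (@lipschitz_continuous _ 1) => {}x y; rewrite mul1r.
by rewrite (le_trans (ler_dist_enorm _ _))// opprB addrA subrK.
Qed.

Lemma cball_bounded (c : 'rV[R]_d) a : bounded_set (cball c a).
Proof.
exists (enorm c + a); split; first exact: num_real.
move=> M cM x /= cx; rewrite (le_trans (norm_le_enorm _))// ltW// (le_lt_trans _ cM)//.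
by rewrite -(subrK c x) (le_trans (ler_enormD _ _))// addrC lerD2l.
Qed.

Lemma compact_cball (c : 'rV[R]_d) a : compact (cball c a).
Proof. by apply: bounded_closed_compact; [exact: cball_bounded|exact: closed_cball]. Qed.

End euclidean_norm.

(** * Lebesgue integrals of test functions *)

Section translation_invariance.
Context {R : realType}.

Lemma measurable_translate n (t : 'rV[R]_n) :
  measurable_fun setT (fun x : 'rV[R]_n => x + t).
Proof.
apply: measurable_fun_rV => i; under eq_fun do rewrite mxE.
by apply: measurable_funD => //; exact: measurable_coord.
Qed.

Lemma lebesgue_measure_translate (a : R) (A : set (measurableTypeR R)) :
  measurable A ->
  lebesgue_measure ((fun x => x + a) @^-1` A) = lebesgue_measure A.
Proof.
move=> mA.
have mphi : measurable_fun setT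
    (fun x : measurableTypeR R => x + a : measurableTypeR R).
  by apply: measurable_funD.
pose phi : {mfun measurableTypeR R >-> measurableTypeR R} :=
  HB.pack (fun x : measurableTypeR R => x + a : measurableTypeR R)
    (isMeasurableFun.Build _ _ _ _ _ mphi).
rewrite -[LHS]/(pushforward lebesgue_measure phi A).
apply/esym/lebesgue_measure_unique => //= _ [[x y]] _ <-.
rewrite /pushforward.
have -> : phi @^-1` `]x, y] = `]x - a, y - a]%classic.
  by apply/seteqP; split => z /=; rewrite !in_itv /= ltrBlDr lerBrDr.
rewrite !lebesgue_measure_itv /= !lte_fin ltrD2r -!EFinB.
by case: ifP => // _; congr EFin; ring.
Qed.

Lemma lebesgue_rV_translate n (t : 'rV[R]_n) (A : set 'rV[R]_n) :
  measurable A -> lebesgue_rV R n ((fun x => x + t) @^-1` A) = lebesgue_rV R n A.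
Proof.
elim: n t A => [|n IH] t A mA.
  by congr (_ _); apply: eq_set => x; rewrite [x + t]thinmx0 [x in RHS]thinmx0.
rewrite /= /lebesgue_step /pushforward /=.
set B := @row_cons R n @^-1` A.
pose t' : 'rV[R]_n := \row_i t ord0 (rshift 1 i).
pose t0 : R := t ord0 ord0.
have mB : measurable B.
  by rewrite -[B]setTI; apply: (measurable_row_cons (R := R)) => //.
have cons_translate x y :
    row_cons (x, y) + t = row_cons (x + t', y + t0) :> 'rV[R]_n.+1.
  apply/rowP => i; rewrite mxE /row_cons /=.
  rewrite -(@fintype.splitK 1 n i); case: (@fintype.split 1 n i) => j /=.
    rewrite !(row_mxEl (_ : 'rV[R]_1)) (ord1 j) !mxE eqxx !mulr1n.
    by congr (_ + t _ _); exact: val_inj.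
  by rewrite !(row_mxEr (_ : 'rV[R]_1)) !mxE.
have eqB x : xsection (@row_cons R n @^-1` ((fun x => x + t) @^-1` A)) x =
    (fun y => y + t0) @^-1` xsection B (x + t').
  by apply/seteqP; split => y; rewrite /xsection /= !inE /B /= cons_translate.
pose g := fun x => lebesgue_measure (xsection B x).
transitivity (\int[lebesgue_rV R n]_x g (x + t')%R)%E.
  apply: eq_integral => x _ /=; rewrite eqB lebesgue_measure_translate//.
  exact: measurable_xsection.
have mg : measurable_fun setT g by exact: measurable_fun_xsection.
have mt := measurable_translate t'.
pose phi : {mfun 'rV[R]_n >-> 'rV[R]_n} :=
  HB.pack (fun x : 'rV[R]_n => x + t') (isMeasurableFun.Build _ _ _ _ _ mt).
transitivity (\int[pushforward (lebesgue_rV R n) phi]_x g x)%E.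
  by rewrite [RHS]ge0_integral_pushforward.
by apply: eq_measure_integral => C mC _; exact: IH.
Qed.

Lemma lebesgue_rV_cube n (M : R) : 0 <= M ->
  lebesgue_rV R n [set x | forall i, `|x ord0 i| <= M] = ((2 * M) ^+ n)%:E.
Proof.
move=> M0.
have itvE : [set y | `|y| <= M] = `[- M, M]%classic.
  by apply/seteqP; split => y /=; rewrite in_itv /= ler_norml.
rewrite (@lebesgue_rV_box _ n (fun=> [set y | `|y| <= M])) ?itvE//.
under eq_bigr do rewrite lebesgue_measure_itv /=.
have -> : (if (- M)%:E < M%:E then M%:E - (- M)%:E else 0)%E = (2 * M)%:E.
  rewrite lte_fin; case: ifPn => [_|]; first by rewrite -EFinB opprK mulr2n mulrDl mul1r.
  by rewrite -leNgt => ?; congr EFin; lra.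
elim: n => [|n IH]; first by rewrite big_ord0.
by rewrite big_ord_recl IH exprS EFinM.
Qed.

End translation_invariance.

Section test_functions.
Context {R : realType} {d : nat}.
Local Notation E := 'rV[R]_d.
Local Notation leb := (lebesgue_rV R d).
Implicit Types (f g : E -> R).

Definition test_fun f :=
  continuous f /\ exists M, forall x, f x != 0 -> enorm x <= M.

Lemma measurable_continuous f : continuous f -> measurable_fun setT f.
Proof.
move=> cf; apply: (measurability _ (RGenOpens.measurableE R)).
move=> _ [_ [a [b ->] <-]]; rewrite setTI; apply: sub_sigma_algebra.
by apply: open_comp; [move=> x _; exact: cf|exact: interval_open].
Qed.

Lemma test_fun_support f : test_fun f ->
  exists2 M, 0 <= M & forall x, f x != 0 -> enorm x <= M.
Proof.
move=> [_ [M fM]]; exists `|M| => // x /fM xM.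
by rewrite (le_trans xM) ?ler_norm.
Qed.

Lemma test_fun_compact f : test_fun f -> compactly_supported f.
Proof.
move=> [cf [M fM]]; apply: (@subclosed_compact _ _ (cball (0 : E) M)).
- exact: closed_closure.
- exact: compact_cball.
rewrite [X in _ `<=` X](closure_id _).1; last exact: closed_cball.
by apply: closure_subset => x /= /fM; rewrite /cball /= subr0.
Qed.

Definition cube (M : R) : set E := [set x | forall i, `|x ord0 i| <= M].

Lemma compact_cube M : compact (cube M).
Proof.
have -> : cube M = [set v : E | forall i, v ord0 i \in `[- M, M]].
  by apply/seteqP; split => x Qx i; have := Qx i; rewrite /= in_itv /= ler_norml.
by apply: (@rV_compact _ _ (fun=> `[- M, M]%classic)) => _; exact: segment_compact.
Qed.

Lemma measurable_compact (A : set E) : compact A -> measurable A.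
Proof.
move=> cA; have oA : open (~` A).
  by rewrite openC; apply: compact_closed cA; exact: norm_hausdorff.
by rewrite -[A]setCK; apply: measurableC; exact: sub_sigma_algebra.
Qed.

Lemma cube_sub_cball M r : 0 <= M -> d%:R * M <= r -> cube M `<=` cball 0 r.
Proof.
by move=> M0 Mr x Mx; rewrite /cball /= subr0 (le_trans _ Mr)// enorm_le.
Qed.

Lemma test_fun_integrable f : test_fun f -> leb.-integrable setT (EFin \o f).
Proof.
move=> tf; have [M M0 fM] := test_fun_support tf; have [cf _] := tf.
pose Q : set E := cube M.
have cQ := @compact_cube M.
have mQ := measurable_compact cQ.
have fQ : leb.-integrable Q (EFin \o f).
  apply: measurable_bounded_integrable => //.
  - by rewrite lebesgue_rV_cube// ltry.
  - apply: measurable_funTS; exact: measurable_continuous.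
  have : compact (f @` Q).
    by apply: continuous_compact => //; exact: continuous_subspaceT.
  move=> /compact_bounded[C [Cr fC]]; exists C; split => // y Cy x Qx.
  by apply: (fC y Cy (f x)); exists x.
have -> : EFin \o f = (EFin \o f) \_ Q.
  apply/funext => x; rewrite patchE; case: ifPn => // /negP xQ /=.
  apply/eqP; rewrite eqe; apply/negPn/negP => /fM xM; apply: xQ; rewrite inE => i.
  by rewrite (le_trans (coord_le_enorm _ _)).
by apply/(integrable_mkcond _ mQ).
Qed.

Lemma continuous_translate f (t : E) :
  continuous f -> continuous (fun x : E => f (x + t)).
Proof.
move=> cf x; apply: (@continuous_comp _ _ _ (fun y : E => y + t) f); last exact: cf.
by apply: (@continuousD _ _ _ (fun z : E => z) (cst t)); [apply: cvg_id|apply: cst_continuous].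
Qed.

Lemma test_fun_translate f t : test_fun f -> test_fun (fun x => f (x + t)).
Proof.
move=> [cf [M fM]]; split; first exact: continuous_translate.
exists (M + enorm t) => x /fM xtM.
by rewrite -(addrK t x) (le_trans (ler_enormB _ _))// lerD2r.
Qed.

Lemma test_funM f g : test_fun f -> continuous g -> test_fun (fun x => f x * g x).
Proof.
move=> [cf [M fM]] cg; split; last first.
  by exists M => x; rewrite mulf_eq0 negb_or => /andP[/fM].
by move=> x; apply: continuousM; [exact: cf|exact: cg].
Qed.

Lemma test_funB f g : test_fun f -> test_fun g -> test_fun (fun x => f x - g x).
Proof.
move=> [cf [M fM]] [cg [N gN]]; split.
  by move=> x; apply: continuousB; [exact: cf|exact: cg].
exists (Num.max M N) => x; rewrite le_max; have [fx|/fM ->//] := eqVneq (f x) 0.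
by rewrite fx sub0r oppr_eq0 => /gN ->; rewrite orbT.
Qed.

Lemma test_funD f g : test_fun f -> test_fun g -> test_fun (fun x => f x + g x).
Proof.
move=> [cf [M fM]] [cg [N gN]]; split.
  by move=> x; apply: continuousD; [exact: cf|exact: cg].
exists (Num.max M N) => x; rewrite le_max; have [fx|/fM ->//] := eqVneq (f x) 0.
by rewrite fx add0r => /gN ->; rewrite orbT.
Qed.

Lemma Rintegral_translate f (t : E) : test_fun f ->
  \int[leb]_x f (x + t) = \int[leb]_x f x.
Proof.
move=> tf; have mt := @measurable_translate R d t.
pose phi : {mfun E >-> E} :=
  HB.pack (fun x : E => x + t) (isMeasurableFun.Build _ _ _ _ _ mt).
congr fine.
transitivity (\int[pushforward leb phi]_x (f x)%:E)%E.
  rewrite [RHS]integral_pushforward//=.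
    by apply/measurable_EFinP; apply: measurable_continuous; case: tf.
  by apply: (@test_fun_integrable (fun x => f (x + t))); exact: test_fun_translate.
by apply: eq_measure_integral => C mC _; exact: lebesgue_rV_translate.
Qed.

Lemma test_integralB f g : test_fun f -> test_fun g ->
  \int[leb]_x (f x - g x) = \int[leb]_x f x - \int[leb]_x g x.
Proof. by move=> tf tg; rewrite RintegralB//; exact: test_fun_integrable. Qed.

Lemma test_integralD f g : test_fun f -> test_fun g ->
  \int[leb]_x (f x + g x) = \int[leb]_x f x + \int[leb]_x g x.
Proof. by move=> tf tg; rewrite RintegralD//; exact: test_fun_integrable. Qed.

End test_functions.

(** * Bump functions and their autocorrelation *)

Section bump.
Context {R : realType} {d : nat}.
Local Notation E := 'rV[R]_d.
Local Notation leb := (lebesgue_rV R d).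
Variable s : R.
Hypothesis s0 : 0 < s.

Definition bump (x : E) : R := Num.max 0 (s - enorm x).

Lemma bump_ge0 x : 0 <= bump x.
Proof. by rewrite le_max lexx. Qed.

Lemma bump_support x : bump x != 0 -> enorm x <= s.
Proof.
by apply: contra_neqT; rewrite -ltNge => sx; rewrite /bump max_l// subr_le0 ltW.
Qed.

Lemma bump_lipschitz x y : `|bump x - bump y| <= enorm (x - y).
Proof.
rewrite (le_trans _ (ler_dist_enorm x y))// /bump /Num.max.
by case: ltrP => ?; case: ltrP => ?; rewrite ler_norml; apply/andP; split;
  rewrite ?subrr ?oppr_le0 ?normr_ge0// ?ler_normr;
  have := ler_norm (enorm x - enorm y); have := ler_norm (- (enorm x - enorm y));
  rewrite normrN; lra.
Qed.

Lemma test_fun_bump : test_fun bump.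
Proof.
split; last by exists s => x; exact: bump_support.
by apply: (@lipschitz_continuous _ _ _ 1) => x y; rewrite mul1r bump_lipschitz.
Qed.

Definition autocorr (z : E) : R := \int[leb]_y (bump y * bump (y - z)).

Let test_fun2 (a b : E) : test_fun (fun y => bump (y + a) * bump (y + b)).
Proof.
apply: test_funM; first exact/test_fun_translate/test_fun_bump.
by apply: continuous_translate; case: test_fun_bump.
Qed.

Lemma integral_bump2 (a b : E) :
  \int[leb]_y (bump (y + a) * bump (y + b)) = autocorr (a - b).
Proof.
have := @test_fun2 0 (b - a) => /(@Rintegral_translate _ _ _ a) h.
rewrite /autocorr opprB; transitivity (\int[leb]_y (bump (y + 0) * bump (y + (b - a)))).
  by rewrite -h; apply: eq_Rintegral => y _; rewrite addr0 -addrA (addrC a) subrK.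
by apply: eq_Rintegral => y _; rewrite addr0.
Qed.

Lemma autocorr_ge0 z : 0 <= autocorr z.
Proof. by apply: Rintegral_ge0 => y _; rewrite mulr_ge0 ?bump_ge0. Qed.

Lemma autocorr_le z : autocorr z <= autocorr 0.
Proof.
have tD a := test_fun_integrable (test_funD (@test_fun2 a a) (@test_fun2 (- z) (- z))).
have tD' := test_fun_integrable (test_funD (@test_fun2 0 (- z)) (@test_fun2 0 (- z))).
have double (a b : R) : a + a <= b + b -> a <= b by lra.
have sq (a b : R) : a * b + a * b <= a * a + b * b by have := sqr_ge0 (a - b); lra.
have := @le_Rintegral _ _ _ leb setT _ _ measurableT tD' (tD 0) (fun y _ => sq _ _).
rewrite (test_integralD (@test_fun2 0 (- z)) (@test_fun2 0 (- z))).
rewrite (test_integralD (@test_fun2 0 0) (@test_fun2 (- z) (- z))).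
by rewrite !integral_bump2 !subrr opprK add0r; exact: double.
Qed.

Lemma autocorr_support z : autocorr z != 0 -> enorm z <= 2 * s.
Proof.
apply: contra_neqT; rewrite -ltNge => sz; rewrite /autocorr.
rewrite (@eq_Rintegral _ _ _ _ _ (cst 0)); first by rewrite Rintegral_cst// mul0r.
move=> y _; apply/eqP; rewrite mulf_eq0; apply/negPn; rewrite negb_or.
apply/negP => /andP[/bump_support y1 /bump_support y2].
by have := ler_enorm_sub y (y - z); have := @ler_enormB _ _ y (y - z); rewrite subKr; lra.
Qed.

Lemma test_fun_autocorr : test_fun autocorr.
Proof.
split; last by exists (2 * s) => z; exact: autocorr_support.
have F0 : 0 <= \int[leb]_y (bump y) by apply: Rintegral_ge0 => y _; exact: bump_ge0.
apply: (@lipschitz_continuous _ _ _ (\int[leb]_y (bump y))) => x y.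
have tz (z : E) : test_fun (fun u => bump u * bump (u - z)).
  by have := @test_fun2 0 (- z); under eq_fun do rewrite addr0.
rewrite -test_integralB// (le_trans (le_normr_Rintegral _ _))//.
  by apply/test_fun_integrable/test_funB.
rewrite -RintegralZr//; last exact/test_fun_integrable/test_fun_bump.
apply: le_Rintegral => //.
- by apply: integrable_norm; apply/test_fun_integrable/test_funB.
- apply: (@test_fun_integrable _ _ (fun u => bump u * enorm (x - y))).
  by apply: test_funM; [exact: test_fun_bump|exact: cst_continuous].
move=> u _; rewrite -mulrBr normrM ger0_norm ?bump_ge0// ler_wpM2l ?bump_ge0//.
by rewrite (le_trans (bump_lipschitz _ _))// enormB opprB addrC addrA subrK.
Qed.

Lemma autocorr0_gt0 : 0 < autocorr 0.
Proof.
pose c := s / (2 * d.+1%:R).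
have d1 : 0 < d.+1%:R :> R by rewrite ltr0n.
have c0 : 0 < c by rewrite divr_gt0// mulr_gt0.
have cs : d%:R * c <= s / 2.
  rewrite /c mulrA ler_pdivrMr ?mulr_gt0// mulrA divfK ?pnatr_eq0//.
  by rewrite mulrC ler_wpM2l ?ler_nat// ltW.
have mQ := measurable_compact (@compact_cube R d c).
have tf : test_fun (fun y => bump y * bump (y - 0)).
  by have := @test_fun2 0 (- 0); under eq_fun do rewrite addr0.
have mf : measurable_fun setT (fun y => (bump y * bump (y - 0))%:E).
  by apply/measurable_EFinP; apply: measurable_continuous; case: tf.
rewrite /autocorr /Rintegral fine_gt0//; apply/andP; split; last first.
  exact: (integrable_lty _ (test_fun_integrable tf)).
apply: (@lt_le_trans _ _ (\int[leb]_(x in cube c) ((s / 2) ^+ 2)%:E)%E).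
  rewrite integral_cst// lebesgue_rV_cube ?ltW// -EFinM lte_fin.
  by rewrite mulr_gt0// exprn_gt0// ?divr_gt0 ?mulr_gt0.
apply: (@le_trans _ _ (\int[leb]_(x in cube c) (bump x * bump (x - 0))%:E)%E).
  apply: ge0_le_integral => //=.
  - by move=> x _; rewrite lee_fin sqr_ge0.
  - exact: measurable_funTS.
  move=> x /(cube_sub_cball (ltW c0) cs); rewrite /cball /= !subr0 => xs.
  have : s / 2 <= bump x by rewrite le_max; apply/orP; right; lra.
  by move=> h; rewrite lee_fin expr2 ler_pM// divr_ge0 ?ltW.
by apply: ge0_subset_integral => //==> x _; rewrite lee_fin mulr_ge0 ?bump_ge0.
Qed.
End bump.

Section difference.
Context {R : realType} {d : nat}.
Local Open Scope complex_scope.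
Local Notation E := 'rV[R]_d.
Local Notation leb := (lebesgue_rV R d).
Variable s : R.
Hypothesis s0 : 0 < s.
Local Notation bump := (@bump R d s).
Local Notation autocorr := (@autocorr R d s).

Definition bumpc (x : E) : complex R := (bump x)%:C.
Definition bump_diff (t x : E) : complex R := (bump x - bump (x - t))%:C.

Lemma Cc_real (f : E -> R) : test_fun f -> Cc (fun x => (f x)%:C).
Proof.
move=> tf; split => /=; [by case: tf|exact: cst_continuous|].
rewrite /compactly_supported (_ : [set x | _] = [set x | f x != 0]).
  exact: (test_fun_compact tf).
by apply/seteqP; split => x /=; rewrite eq_complex /= eqxx andbT.
Qed.

Lemma Cc_bumpc : Cc bumpc.
Proof. exact/Cc_real/test_fun_bump. Qed.

Lemma Cc_bump_diff t : Cc (bump_diff t).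
Proof.
apply/(@Cc_real (fun x => bump x - bump (x - t)))/test_funB.
  exact: test_fun_bump.
exact/test_fun_translate/test_fun_bump.
Qed.

Let test_bump2 (a b : E) : test_fun (fun y => bump (y + a) * bump (y + b)).
Proof.
apply: test_funM; first exact/test_fun_translate/test_fun_bump.
by apply: continuous_translate; case: (@test_fun_bump R d s).
Qed.

Lemma convolution_bump_diff t z :
  complex.Re (convolution (bump_diff t) (involution (bump_diff t)) z) =
  2 * autocorr z - autocorr (z - t) - autocorr (z + t).
Proof.
rewrite /convolution /cintegral /=.
transitivity (\int[leb]_y (
   (bump (y + 0) * bump (y + - z) - bump (y - t) * bump (y + - z))
   - (bump (y + 0) * bump (y + (- z - t)) - bump (y - t) * bump (y + (- z - t))))).
  apply: eq_Rintegral => y _ /=.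
  by rewrite oppr0 !mulr0 subr0 addr0 opprB !addrA; ring.
rewrite !test_integralB//; try exact: test_funB.
rewrite !integral_bump2.
have -> : 0 - - z = z by rewrite opprK add0r.
have -> : - t - - z = z - t by rewrite opprK addrC.
have -> : 0 - (- z - t) = z + t by rewrite opprD !opprK add0r.
have -> : - t - (- z - t) = z by rewrite opprD !opprK addrCA addNr addr0.
by move: (autocorr z) (autocorr (z - t)) (autocorr (z + t)) => a b c; ring.
Qed.

Lemma sqnormc_bump_diff t k :
  sqnormc (inv_fourier (bump_diff t) k) =
  (2 - 2 * cos (2 * pi * dotp k t)) * sqnormc (inv_fourier bumpc k).
Proof.
pose th x := 2 * pi * dotp k x.
have thB x y : th (x - y) = th x - th y.
  by rewrite /th dotpDr dotpNr mulrBr.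
have cth : continuous th.
  move=> x; apply: (@continuousM _ _ (cst (2 * pi)) (dotp k)); first exact: cst_continuous.
  exact: continuous_dotpr.
have ccos : continuous (fun x => cos (th x)).
  by move=> x; apply: continuous_comp; [exact: cth|exact: continuous_cos].
have csin : continuous (fun x => sin (th x)).
  by move=> x; apply: continuous_comp; [exact: cth|exact: continuous_sin].
have tb := @test_fun_bump R d s.
pose A := \int[leb]_x (bump x * cos (th x)).
pose B := \int[leb]_x (bump x * sin (th x)).
have tA : test_fun (fun x => bump x * cos (th x)) by exact: test_funM.
have tB : test_fun (fun x => bump x * sin (th x)) by exact: test_funM.
have cst_test (f : E -> R) c : test_fun f -> test_fun (fun x => f x * c).
  by move=> tf; apply: test_funM => //; exact: cst_continuous.
have -> : inv_fourier bumpc k = A +i* B.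
  congr (_ +i* _); apply: eq_Rintegral => x _ /=; rewrite mul0r ?subr0 ?addr0 //.
have shiftA : \int[leb]_x (bump (x - t) * cos (th x)) = A * cos (th t) - B * sin (th t).
  rewrite /A /B -!RintegralZr//; try exact: test_fun_integrable.
  rewrite -test_integralB; try exact: cst_test.
  rewrite -[RHS](@Rintegral_translate _ _ _ (- t)); last by apply: test_funB; exact: cst_test.
  apply: eq_Rintegral => x _; rewrite thB.
  have -> : cos (th x) = cos ((th x - th t) + th t) by rewrite subrK.
  by rewrite cosD; ring.
have shiftB : \int[leb]_x (bump (x - t) * sin (th x)) = A * sin (th t) + B * cos (th t).
  rewrite /A /B -!RintegralZr//; try exact: test_fun_integrable.
  rewrite -test_integralD; try exact: cst_test.
  rewrite -[RHS](@Rintegral_translate _ _ _ (- t)); last by apply: test_funD; exact: cst_test.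
  apply: eq_Rintegral => x _; rewrite thB.
  have -> : sin (th x) = sin ((th x - th t) + th t) by rewrite subrK.
  by rewrite sinD; ring.
have -> : inv_fourier (bump_diff t) k =
    (A - (A * cos (th t) - B * sin (th t))) +i* (B - (A * sin (th t) + B * cos (th t))).
  rewrite -shiftA -shiftB /A /B -!test_integralB//;
    try (by apply: test_funM => //; exact: test_fun_translate).
  by congr (_ +i* _); apply: eq_Rintegral => x _ /=; rewrite mul0r ?subr0 ?addr0 mulrBl.
have := cos2Dsin2 (th t); rewrite /sqnormc /= -/(th t).
set c := cos _; set sn := sin _ => h.
have {}h : sn ^+ 2 = 1 - c ^+ 2 by lra.
transitivity ((A ^+ 2 + B ^+ 2) * ((1 - c) ^+ 2 + sn ^+ 2)); first by ring.
by rewrite h; ring.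
Qed.

End difference.

(** * Almost periods of pure point measures *)

Section dirichlet.
Context {R : realType}.

(* Pigeonhole on the values of the cosines and sines up to precision 1/N. *)
Lemma dirichlet_cos (th : seq R) (eta : R) : 0 < eta ->
  exists2 p : nat, (0 < p)%N &
    forall a, a \in th -> 2 - 2 * cos (p%:R * a) <= eta.
Proof.
move=> eta0; pose N := (Num.truncn (Num.max 1 (2 / eta))).+1.
have N_ge1 : 1 <= N%:R :> R by rewrite ler1n.
have N0 : 0 < N%:R :> R by rewrite ltr0n.
have N_eta : 2 / eta <= N%:R.
  have : 2 / eta <= Num.max 1 (2 / eta) by rewrite le_max lexx orbT.
  by move/le_trans; apply; exact/ltW/truncnS_gt.
pose q (x : R) : 'I_(N.*2).+1 := inord (Num.truncn (N%:R * (x + 1))).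
have qP x y : -1 <= x <= 1 -> -1 <= y <= 1 -> q x = q y ->
    (x - y) ^+ 2 <= N%:R^-1 ^+ 2.
  have small (z : R) : -1 <= z <= 1 -> (Num.truncn (N%:R * (z + 1)) < (N.*2).+1)%N.
    move=> /andP[z1 z2]; rewrite ltnS -(ler_nat R); apply: (@le_trans _ _ (N%:R * (z + 1))).
      by rewrite truncn_le mulr_ge0// -lerBlDr sub0r.
    by rewrite -muln2 natrM ler_pM2l//; lra.
  move=> hx hy /(congr1 (@nat_of_ord _)); rewrite /q !inordK ?small// => e.
  have x0 : 0 <= N%:R * (x + 1) by rewrite mulr_ge0// -lerBlDr sub0r; case/andP: hx.
  have y0 : 0 <= N%:R * (y + 1) by rewrite mulr_ge0// -lerBlDr sub0r; case/andP: hy.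
  have /andP[x1 x2] := truncn_itv x0; have /andP[y1 y2] := truncn_itv y0.
  rewrite -e in y1 y2; move: x2 y2; rewrite -natr1 => x2 y2.
  rewrite -(real_normK (num_real (x - y))) (@ler_pXn2r _ 2)// ?nnegrE ?invr_ge0//.
  rewrite -(ler_pM2l N0) mulfV ?gt_eqF// -{1}(ger0_norm (ltW N0)) -normrM.
  by rewrite ler_norml; apply/andP; split; lra.
pose n := size th.
pose C := {ffun 'I_n -> 'I_(N.*2).+1 * 'I_(N.*2).+1}.
pose f (p : 'I_#|C|.+1) : C :=
  [ffun i : 'I_n => (q (cos (p%:R * th`_i)), q (sin (p%:R * th`_i)))].
have : ~~ injectiveb f.
  by apply/negP => /injectiveP/leq_card; rewrite card_ord ltnn.
case/injectivePn => i [j ij fij].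
wlog lt_ij : i j ij fij / (j < i)%N.
  move=> h; have [|ji] := leqP i j; last exact: (h i j).
  rewrite leq_eqVlt => /orP[/eqP/val_inj/eqP|ji]; first by rewrite (negbTE ij).
  by apply: (h j i) => //; rewrite eq_sym.
exists (i - j)%N; first by rewrite subn_gt0.
move=> a /(nthP 0)[k kn <-].
have /ffunP/(_ (Ordinal kn)) := fij; rewrite !ffunE /= => -[/qP h1 /qP h2].
rewrite (natrB _ (ltnW lt_ij)) mulrBl cosB.
have {h1} := h1; rewrite !cos_geN1 !cos_le1 => /(_ isT isT) h1.
have {h2} := h2; rewrite !sin_geN1 !sin_le1 => /(_ isT isT) h2.
have e1 := cos2Dsin2 (i%:R * th`_k); have e2 := cos2Dsin2 (j%:R * th`_k).
have : 2 * N%:R^-1 ^+ 2 <= eta.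
  rewrite expr2 mulrA (@le_trans _ _ (2 / N%:R))//.
    by rewrite ler_piMr ?invf_le1// mulr_ge0// invr_ge0.
  by move: N_eta; rewrite ler_pdivrMr// ler_pdivrMr// mulrC.
by move=> h; apply: le_trans h; nra.
Qed.

End dirichlet.

Section pure_point_integral.
Context {R : realType} {d : nat}.
Local Notation E := 'rV[R]_d.
Variable nu : {measure set E -> \bar R}.
Hypotheses (nu_lf : locally_finite nu) (nu_pp : pure_point nu).
Variable g : E -> R.
Hypotheses (g0 : forall k, 0 <= g k) (ig : nu.-integrable setT (EFin \o g)).
Local Open Scope ereal_scope.

Let mfin (A : set E) : finite_set A -> measurable A.
Proof.
move=> fA; apply: measurable_compact; apply: finite_compact.
exact: fA.
Qed.

Let atoms (n : nat) : set E :=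
  [set k | (enorm k <= n%:R)%R /\ (n.+1%:R^-1)%:E <= nu [set k]].

Let finite_atoms n : finite_set (atoms n).
Proof.
apply: contrapT => /infinite_set_fset inf.
have mB := measurable_compact (@compact_cball R d 0 n%:R).
have fB := nu_lf (@compact_cball R d 0 n%:R).
have [M nuM] : exists M : nat, nu (cball (0 : E) n%:R) < (M%:R / n.+1%:R)%:E.
  exists (Num.truncn (n.+1%:R * fine (nu (cball (0 : E) n%:R)))).+1.
  rewrite -[ltLHS]fineK ?ge0_fin_numE// lte_fin ltr_pdivlMr ?ltr0n// mulrC.
  exact: truncnS_gt.
have [B sB cB] := inf M.
have := nuM; apply/negP; rewrite -leNgt nu_pp//.
apply: esum_ge; exists [set` B].
  split; first exact: finite_fset.
  by move=> k /sB[]; rewrite /cball /= subr0.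
rewrite fsbig_finite//= set_fsetK.
apply: (@le_trans _ _ (\sum_(k <- B) (n.+1%:R^-1)%:E)).
  rewrite sumEFin lee_fin big_const_seq iter_addr_0 count_predT.
  by rewrite -(mulr_natl _ (size _)) ler_wpM2r ?invr_ge0// ler_nat.
by rewrite big_seq [leRHS]big_seq; apply: lee_sum => k kB; case: (sB k kB).
Qed.

Lemma pure_point_integral_tail (e : R) : (0 < e)%R ->
  exists A : set E, finite_set A /\ \int[nu]_(k in ~` A) (g k)%:E <= e%:E.
Proof.
move=> e0; pose D := \bigcup_n atoms n.
have mg : measurable_fun setT (EFin \o g) by exact: measurable_int ig.
have mA n : measurable (atoms n) by exact: mfin.
have mD : measurable D by exact: bigcup_measurable.
have nd : nondecreasing_seq atoms.
  move=> m n mn; rewrite subsetEset => k [km nuk]; split.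
    by rewrite (le_trans km)// ler_nat.
  by rewrite (le_trans _ nuk)// lee_fin lef_pV2 ?posrE// ler_nat.
have nuD : nu (~` D) = 0.
  rewrite nu_pp; last exact: measurableC.
  apply: esum1 => k Dk; apply/eqP; rewrite eq_le measure_ge0 andbT leNgt.
  apply/negP => nuk; apply: Dk.
  have fk : nu [set k] < +oo by exact/nu_lf/compact_set1.
  have k0 : (0 < fine (nu [set k]))%R by rewrite fine_gt0// nuk.
  pose n := maxn (Num.truncn (fine (nu [set k]))^-1) (Num.truncn (enorm k)).+1.
  exists n => //; split.
    by rewrite (le_trans (ltW (truncnS_gt _)))// ler_nat leq_maxr.
  rewrite -[leRHS]fineK ?ge0_fin_numE// lee_fin invf_ple ?posrE ?ltr0n//.
  by rewrite (le_trans (ltW (truncnS_gt _)))// ler_nat ltnS leq_maxl.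
have gD : \int[nu]_(k in ~` D) (g k)%:E = 0.
  by apply: null_set_integral => //; [exact: measurableC|exact: measurable_funTS].
have gE (A : set E) : measurable A ->
    \int[nu]_k (g k)%:E = \int[nu]_(k in A) (g k)%:E + \int[nu]_(k in ~` A) (g k)%:E.
  move=> mA'; rewrite -ge0_integral_setU ?setUv//; first exact: measurableC.
    by move=> x _; rewrite lee_fin.
  by rewrite disj_set2E setICr.
have gfin : \int[nu]_k (g k)%:E < +oo by exact: (integrable_lty _ ig).
have g0' n x : atoms n x -> 0 <= (EFin \o g) x by move=> _; rewrite lee_fin.
have cvgI := @ge0_nondecreasing_set_cvg_integral _ _ _ _ _ nu
  nd mA (fun n => measurable_funTS mg) g0'.
apply: contrapT => /forallNP tail.
have {}tail n : e%:E < \int[nu]_(k in ~` atoms n) (g k)%:E.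
  by rewrite ltNge; apply/negP => h; apply: (tail (atoms n)).
have : \int[nu]_k (g k)%:E <= \int[nu]_k (g k)%:E - e%:E.
  rewrite {1}(gE _ mD) gD adde0 -(cvg_lim _ cvgI)//.
  apply: lime_le; first by apply/cvg_ex; eexists; exact: cvgI.
  apply: nearW => n; rewrite leeBrDr// (gE _ (mA n)).
  by rewrite leeD2l// ltW.
apply/negP; rewrite -ltNge lteBlDr// lteDl ?lte_fin//.
by rewrite ge0_fin_numE// integral_ge0// => k _; rewrite lee_fin.
Qed.

End pure_point_integral.

Lemma pure_point_almost_period (R : realType) (d : nat)
    (nu : {measure set 'rV[R]_d -> \bar R}) (g : 'rV[R]_d -> R) (v : 'rV[R]_d)
    (e : R) :
  locally_finite nu -> pure_point nu -> (forall k, 0 <= g k) ->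
  nu.-integrable setT (EFin \o g) -> 0 < e ->
  exists2 p : nat, (0 < p)%N &
    \int[nu]_k ((2 - 2 * cos (2 * pi * dotp k (p%:R *: v))) * g k) <= e.
Proof.
move=> nulf nupp g0 ig e0.
have [A [fA tailA]] := pure_point_integral_tail nulf nupp g0 ig (divr_gt0 e0 (ltr0n R 8)).
pose I := \int[nu]_k g k.
have I0 : 0 <= I by apply: Rintegral_ge0.
have IE : (\int[nu]_k (g k)%:E)%E = I%:E.
  by rewrite /I /Rintegral fineK//; apply: integrable_fin_num.
pose eta := e / (2 * (I + 1)).
have eta0 : 0 < eta by rewrite divr_gt0// mulr_gt0// ltr_wpDl.
pose ks := [seq 2 * pi * dotp k v | k <- fset_set A].
have [p p0 pk] := dirichlet_cos ks eta0; exists p => //.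
pose c k := 2 - 2 * cos (2 * pi * dotp k (p%:R *: v)).
have c0 k : 0 <= c k by have := cos_le1 (2 * pi * dotp k (p%:R *: v)); rewrite /c; lra.
have c4 k : c k <= 4 by have := cos_geN1 (2 * pi * dotp k (p%:R *: v)); rewrite /c; lra.
have cA k : A k -> c k <= eta.
  move=> Ak; rewrite /c dotpZr mulrCA; apply: pk; apply/mapP; exists k => //.
  by rewrite in_fset_set// inE.
have mA : measurable A by apply: measurable_compact; exact: finite_compact.
have mg : measurable_fun setT g by apply/measurable_EFinP; exact: measurable_int ig.
have mc : measurable_fun setT c.
  apply: measurable_funB => //; apply: measurable_funM => //.
  apply: measurable_continuous => k.
  apply: (@continuous_comp _ _ _ (fun k => 2 * pi * dotp k (p%:R *: v)) cos);
    last exact: continuous_cos.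
  apply: (@continuousM _ _ (cst (2 * pi)) (fun k => dotp k (p%:R *: v))).
    exact: cst_continuous.
  exact: continuous_dotp.
have mcg : measurable_fun setT (fun k => (c k * g k)%:E).
  by apply/measurable_EFinP; exact: measurable_funM.
have cg0 k : (0 <= (c k * g k)%:E)%E by rewrite lee_fin mulr_ge0.
suff : (\int[nu]_k (c k * g k)%:E <= e%:E)%E.
  move=> h; rewrite -lee_fin /Rintegral fineK// ge0_fin_numE; last first.
    by apply: integral_ge0 => k _; exact: cg0.
  by rewrite (le_lt_trans h) ?ltry.
have -> : (\int[nu]_k (c k * g k)%:E =
    \int[nu]_(k in A) (c k * g k)%:E + \int[nu]_(k in ~` A) (c k * g k)%:E)%E.
  rewrite -ge0_integral_setU ?setUv//; first exact: measurableC.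
  by rewrite disj_set2E setICr.
apply: (@le_trans _ _ ((e / 2)%:E + (e / 2)%:E)%E); last by rewrite -EFinD -splitr.
apply: leeD.
  apply: (@le_trans _ _ (\int[nu]_(k in A) (eta%:E * (g k)%:E))%E).
    apply: ge0_le_integral => //=.
    - exact: measurable_funTS.
    - by apply/measurable_EFinP; apply: measurable_funM => //; exact: measurable_funTS.
    - by move=> k Ak; rewrite lee_fin ler_wpM2r// cA.
  rewrite ge0_integralZl//; last 3 first.
  - by apply/measurable_EFinP; exact: measurable_funTS.
  - by move=> k _; rewrite lee_fin.
  - by rewrite lee_fin ltW.
  apply: (@le_trans _ _ (eta%:E * I%:E)%E).
    apply: lee_wpmul2l; first by rewrite lee_fin ltW.
    rewrite -IE; apply: ge0_subset_integral => //; first by apply/measurable_EFinP.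
    by move=> k _; rewrite lee_fin.
  rewrite -EFinM lee_fin /eta mulrAC ler_pdivrMr ?mulr_gt0 ?ltr_wpDl//.
  by rewrite mulrA divfK ?pnatr_eq0// ler_wpM2l// ?lerDl// ltW.
apply: (@le_trans _ _ (\int[nu]_(k in ~` A) (4%:E * (g k)%:E))%E).
  apply: ge0_le_integral => //=.
  - exact: measurableC.
  - exact: measurable_funTS.
  - by apply/measurable_EFinP; apply: measurable_funM => //; exact: measurable_funTS.
  - by move=> k Ak; rewrite lee_fin ler_wpM2r.
rewrite ge0_integralZl//; last 3 first.
- exact: measurableC.
- by apply/measurable_EFinP; exact: measurable_funTS.
- by move=> k _; rewrite lee_fin.
apply: (@le_trans _ _ (4%:E * (e / 8)%:E)%E); first by rewrite lee_wpmul2l ?lee_fin.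
by rewrite -EFinM lee_fin; lra.
Qed.

(** * Almost periods of point sets *)

Section point_sets.
Context {R : realType} {d : nat}.
Local Notation E := 'rV[R]_d.
Implicit Types (W : set E) (x y t : E).

Definition separated (r : R) W :=
  forall x y, W x -> W y -> enorm (x - y) < r -> x = y.

Definition unmatched W (s : R) t : set E :=
  [set x | W x /\ forall y, W y -> s < enorm (y - x - t)].

Lemma delone_separated r rho W : 0 < r -> delone r rho W -> separated r W.
Proof.
move=> r0 [h _] x y Wx Wy xy; apply: (h y).
  by split.
by split => //; rewrite /oball /= subrr enorm0.
Qed.

(* The grid cells of side 1/m that meet the ball of radius n have at most m n
   steps on each side of the origin along every axis, hence the shift by m n. *)
Definition cell (m n : nat) x : {ffun 'I_d -> 'I_((m * n).*2).+1} :=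
  [ffun i => inord (Num.truncn (m%:R * x ord0 i + (m * n)%:R))].

Lemma cell_coord m n x i : cball (0 : E) n%:R x ->
  (cell m n x i : nat)%:R <= m%:R * x ord0 i + (m * n)%:R < (cell m n x i).+1%:R.
Proof.
rewrite /cball /= subr0 => xn.
have : `|m%:R * x ord0 i| <= (m * n)%:R :> R.
  by rewrite normrM ger0_norm// natrM ler_wpM2l// (le_trans (coord_le_enorm _ _)).
rewrite ler_norml => /andP[h1 h2].
have h0 : 0 <= m%:R * x ord0 i + (m * n)%:R by rewrite -lerBlDr sub0r.
rewrite ffunE inordK ?truncn_itv//.
rewrite ltnS -(ler_nat R); apply: (@le_trans _ _ (m%:R * x ord0 i + (m * n)%:R)).
  by rewrite truncn_le.
by rewrite -addnn natrD lerD2r.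
Qed.

Lemma cell_close m n x y : (0 < m)%N -> cball (0 : E) n%:R x ->
  cball (0 : E) n%:R y -> cell m n x = cell m n y -> enorm (x - y) <= d%:R / m%:R.
Proof.
move=> m0 xn yn xy; have m0R : 0 < m%:R :> R by rewrite ltr0n.
apply: enorm_le; first by rewrite invr_ge0.
move=> i; have := cell_coord m i xn; have := cell_coord m i yn.
rewrite xy -natr1 !mxE => /andP[h1 h2] /andP[h3 h4].
rewrite -(ler_pM2l m0R) mulfV ?gt_eqF// -{1}(ger0_norm (ltW m0R)) -normrM mulrBr ler_norml.
by apply/andP; split; lra.
Qed.

Lemma cell_inj m n r W : (0 < m)%N -> d%:R / m%:R < r -> separated r W ->
  {in W `&` cball 0 n%:R &, injective (cell m n)}.
Proof.
move=> m0 mr sW x y; rewrite !inE => -[Wx xn] [Wy yn] /(cell_close m0 xn yn) xy.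
by apply: sW => //; exact: le_lt_trans mr.
Qed.

Lemma exists_mesh (r : R) : 0 < r -> exists2 m, (0 < m)%N & d%:R / m%:R < r.
Proof.
move=> r0; exists (Num.truncn (d%:R / r)).+1 => //.
by rewrite ltr_pdivrMr ?ltr0n// mulrC -ltr_pdivrMr// truncnS_gt.
Qed.

Lemma separated_finite r W n : 0 < r -> separated r W -> finite_set (W `&` cball 0 n%:R).
Proof.
move=> r0 sW; have [m m0 mr] := exists_mesh r0.
have /inj_card_eq/eq_finite_set <- := cell_inj (n := n) m0 mr sW.
exact: finite_finset.
Qed.

Lemma ncard_le (T : choiceType) (A B : set T) : finite_set B -> A `<=` B ->
  (ncard A <= ncard B)%N.
Proof.
move=> fB AB; apply: fsubset_leq_card; rewrite -fset_set_sub//.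
exact: sub_finite_set fB.
Qed.

Lemma ncard_count (T : choiceType) (A B : set T) : finite_set A -> B `<=` A ->
  ncard B = count [in B] (fset_set A).
Proof.
move=> fA BA; have fB : finite_set B by exact: sub_finite_set fA.
rewrite -size_filter; apply: perm_size; apply: uniq_perm; rewrite ?filter_uniq//.
move=> x; rewrite mem_filter !in_fset_set//.
by apply/idP/andP => [xB|[]//]; split => //; move: xB; rewrite !inE => /BA.
Qed.

Lemma sum_mem_ncard (T : choiceType) (A B : set T) : finite_set A -> B `<=` A ->
  \sum_(x <- fset_set A) ((x \in B)%:R : R) = (ncard B)%:R.
Proof.
move=> fA BA; rewrite (ncard_count fA BA) -sum1_count natr_sum [RHS]big_mkcond.
by apply: eq_bigr => x _; rewrite /=; case: (x \in B).
Qed.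

Lemma fsbig_seq (T : choiceType) (A : set T) (f : T -> R) : finite_set A ->
  \sum_(x \in A) f x = \sum_(x <- fset_set A) f x.
Proof. exact: fsbig_finite. Qed.

End point_sets.

Local Opaque autocorr.

Section autocorr_lower_bound.
Context {R : realType} {d : nat}.
Local Notation E := 'rV[R]_d.
Variables (s r : R) (W A : set E).
Hypotheses (s0 : 0 < s) (sr : 4 * s < r) (sW : separated r W).
Hypotheses (fA : finite_set A) (AW : A `<=` W).
Local Notation ac := (@autocorr R d s).

Lemma sum_autocorr_le (u : E) :
  \sum_(y <- fset_set A) ac (u - y) <=
  ac 0 * (1 - ((u \in [set u | forall y, W y -> 2 * s < enorm (y - u)])%:R)).
Proof.
have [[y0 [Ay0 acy0]]|noy] := pselect (exists y, A y /\ ac (u - y) != 0).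
  have d0 := autocorr_support acy0.
  have y0A : y0 \in fset_set A by rewrite in_fset_set// inE.
  rewrite (bigD1_seq y0 y0A (fset_uniq _))/= big_seq_cond big1 ?addr0; last first.
    move=> y /andP[]; rewrite in_fset_set// inE => Ay yy0.
    apply/eqP; apply: contraNT yy0 => /(autocorr_support) d1.
    apply/eqP/sW; [exact: AW|exact: AW|].
    rewrite (le_lt_trans _ sr)// (le_trans (ler_enorm_dist u _ _))// enormB.
    by rewrite (le_trans (lerD d1 d0)) ?le_eqVlt//; apply/orP; left; apply/eqP; ring.
  rewrite memNset ?subr0 ?mulr1 ?autocorr_le// => /(_ _ (AW Ay0)).
  by rewrite enormB ltNge d0.
rewrite big_seq big1 ?mulr_ge0 ?autocorr_ge0//.
  by case: (u \in _); rewrite ?subrr// subr0.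
move=> y; rewrite in_fset_set// inE => Ay; apply/eqP; apply/negPn/negP => h.
by apply: noy; exists y.
Qed.

Let mem_unm x t : A x -> (x \in unmatched W (2 * s) t `&` A) =
  (x + t \in [set u | forall y, W y -> 2 * s < enorm (y - u)]).
Proof.
move=> Ax; apply/idP/idP; rewrite !inE.
  by move=> [[_ h] _] y Wy; rewrite opprD addrA; exact: h.
by move=> h; split => //; split; [exact: AW|move=> y Wy; rewrite -addrA -opprD; exact: h].
Qed.

Let sum_autocorr_matched x t : A x ->
  \sum_(y <- fset_set A) ac (x - y + t) <=
  ac 0 * (1 - (x \in unmatched W (2 * s) t `&` A)%:R).
Proof.
move=> Ax; rewrite mem_unm//.
under eq_bigr do rewrite addrAC.
exact: sum_autocorr_le.
Qed.

Let autocorr0_le_sum x : A x -> ac 0 <= \sum_(y <- fset_set A) ac (x - y).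
Proof.
move=> Ax; have xA : x \in fset_set A by rewrite in_fset_set// inE.
rewrite (bigD1_seq x xA (fset_uniq _))/= subrr lerDl.
by apply: sumr_ge0 => y _; exact: autocorr_ge0.
Qed.

Lemma autocorr_lower_bound (t : E) :
  ac 0 * ((ncard (unmatched W (2 * s) t `&` A))%:R +
          (ncard (unmatched W (2 * s) (- t) `&` A))%:R) <=
  \sum_(x \in A) \sum_(y \in A)
    (2 * ac (x - y) - ac (x - y - t) - ac (x - y + t)).
Proof.
have combine (a b c k m1 m2 : R) : k <= a -> b <= k * (1 - m2) ->
    c <= k * (1 - m1) -> k * (m1 + m2) <= 2 * a - b - c by lra.
rewrite fsbig_seq// -!(sum_mem_ncard fA (@subIsetr _ _ _)) -big_split mulr_sumr.
rewrite big_seq [leRHS]big_seq; apply: ler_sum => x; rewrite in_fset_set// inE => Ax.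
rewrite fsbig_seq// !sumrB -mulr_sumr.
exact: combine (autocorr0_le_sum Ax) (sum_autocorr_matched (- t) Ax)
  (sum_autocorr_matched t Ax).
Qed.

End autocorr_lower_bound.

Section almost_periods.
Context {R : realType} {d : nat}.
Local Notation E := 'rV[R]_d.

Lemma cball_vol_ge (n : nat) :
  (((2 * (n%:R / d.+1%:R)) ^+ d)%:E <= lebesgue_rV R d (cball (0 : E) n%:R))%E.
Proof.
have M0 : 0 <= n%:R / d.+1%:R :> R by rewrite divr_ge0.
rewrite -lebesgue_rV_cube//; apply: le_measure; rewrite ?inE.
- by apply: measurable_compact; exact: compact_cube.
- by apply: measurable_compact; exact: compact_cball.
apply: cube_sub_cball => //; rewrite mulrCA ler_piMr// ler_pdivrMr ?ltr0n// mul1r.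
by rewrite ler_nat.
Qed.

Lemma cball_vol_lty (n : nat) : (lebesgue_rV R d (cball (0 : E) n%:R) < +oo)%E.
Proof.
apply: (@le_lt_trans _ _ (lebesgue_rV R d (cube n%:R))); last first.
  by rewrite lebesgue_rV_cube ?ltry.
apply: le_measure; rewrite ?inE.
- by apply: measurable_compact; exact: compact_cball.
- by apply: measurable_compact; exact: compact_cube.
by move=> x; rewrite /cball /= subr0 => xn i; exact: le_trans (coord_le_enorm _ _) xn.
Qed.

Lemma vol_cball_ge (n : nat) :
  (2 * (n%:R / d.+1%:R)) ^+ d <= vol (cball (0 : E) n%:R).
Proof.
rewrite -lee_fin fineK ?cball_vol_ge// ge0_fin_numE//; exact: cball_vol_lty.
Qed.

Lemma vol_cball_ge0 (n : nat) : 0 <= vol (cball (0 : E) n%:R).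
Proof. by apply: fine_ge0; exact: measure_ge0. Qed.

Variables (w : set E) (r s e : R) (v : E).
Hypotheses (s0 : 0 < s) (sr : 4 * s < r) (sw : separated r w) (e0 : 0 < e).
Hypothesis w_pp : pure_point_diffractive w.

Lemma almost_period_center :
  exists2 p : nat, (0 < p)%N & exists N : nat, forall n, (N <= n)%N ->
    (vol (cball (0 : E) n%:R))^-1 *
      ((ncard (unmatched w (2 * s) (p%:R *: v) `&` cball 0 n%:R))%:R +
       (ncard (unmatched w (2 * s) (- (p%:R *: v)) `&` cball 0 n%:R))%:R) <= e.
Proof.
have [gamma [nu [[_ w_gamma] [nulf gamma_nu] nupp]]] := w_pp.
pose ac0 := autocorr s (0 : E).
have ac00 : 0 < ac0 by exact: autocorr0_gt0.
pose g (k : E) := sqnormc (inv_fourier (@bumpc R d s) k).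
have g0 k : 0 <= g k by rewrite addr_ge0 ?sqr_ge0.
have ig : nu.-integrable setT (EFin \o g) by case: (gamma_nu _ (@Cc_bumpc R d s)).
have e1 : 0 < ac0 * e / 2 by rewrite divr_gt0 ?mulr_gt0.
have [p p0 pI] := pure_point_almost_period v nulf nupp g0 ig e1.
exists p => //; set t := p%:R *: v in pI *.
pose Phi z := 2 * autocorr s z - autocorr s (z - t) - autocorr s (z + t).
have tPhi : test_fun Phi.
  have ta := @test_fun_autocorr R d s.
  apply: test_funB; last exact: test_fun_translate.
  apply: test_funB; last exact: test_fun_translate.
  have := test_funM ta (@cst_continuous E R 2).
  by under eq_fun do rewrite mulrC.
have PhiI : \int[gamma]_x Phi x <= ac0 * e / 2.
  have [_ /(congr1 (@complex.Re R))] := gamma_nu _ (@Cc_bump_diff R d s t).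
  rewrite /cintegral /=.
  have -> : (fun x => complex.Re (convolution (bump_diff s t)
      (involution (bump_diff s t)) x)) = Phi.
    by apply/funext => z; exact: convolution_bump_diff.
  move=> ->.
  have -> : (fun x => sqnormc (inv_fourier (bump_diff s t) x)) =
      (fun k => (2 - 2 * cos (2 * pi * dotp k t)) * g k).
    by apply/funext => k; exact: sqnormc_bump_diff.
  exact: pI.
have PhiI' : \int[gamma]_x Phi x < ac0 * e.
  by rewrite (le_lt_trans PhiI)// ltr_pdivrMr// ltr_pMr ?mulr_gt0// ltr1n.
have [cPhi _] := tPhi.
have cv := w_gamma Phi cPhi (test_fun_compact tPhi).
have [N _ NP] := cvgr_le _ cv _ PhiI'.
exists N => n Nn; have := NP n Nn.
pose A := w `&` cball (0 : E) n%:R.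
have r0 : 0 < r by rewrite (lt_trans _ sr)// mulr_gt0.
have fA : finite_set A by exact: separated_finite r0 sw.
have unmA t' : unmatched w (2 * s) t' `&` cball 0 n%:R = unmatched w (2 * s) t' `&` A.
  by apply/seteqP; split => x [u xn]; split => //; [split => //; case: u|case: xn].
have := autocorr_lower_bound sr sw fA (@subIsetl _ _ _) t.
rewrite !unmA -/ac0 => h1 h2.
rewrite -(ler_pM2l ac00) mulrCA (le_trans _ h2)// ler_wpM2l// invr_ge0.
exact: vol_cball_ge0.
Qed.

Lemma almost_period_center_each :
  exists2 p : nat, (0 < p)%N & exists N : nat, forall n, (N <= n)%N ->
    forall t, t = p%:R *: v \/ t = - (p%:R *: v) ->
    (vol (cball (0 : E) n%:R))^-1 *
      (ncard (unmatched w (2 * s) t `&` cball 0 n%:R))%:R <= e.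
Proof.
have [p p0 [N NP]] := almost_period_center; exists p => //; exists N => n /NP h t.
have v0 : 0 <= (vol (cball (0 : E) n%:R))^-1 by rewrite invr_ge0 vol_cball_ge0.
by case=> ->; apply: le_trans h; rewrite ler_wpM2l// ?lerDl ?lerDr.
Qed.

End almost_periods.

Section uniform_unmatched.
Context {R : realType} {d : nat}.
Local Notation E := 'rV[R]_d.
Variables (w : set E) (s e : R) (t : E).
Hypotheses (ucf : uniform_cluster_frequencies w) (e0 : 0 < e) (s0 : 0 < s) (st : s < enorm t).
Let freq (c : E) (n : nat) : R := (vol (cball (0 : E) n%:R))^-1 *
  (ncard (unmatched w s t `&` cball c n%:R))%:R.

(* A point of w is unmatched iff its cluster on the union of {0} and B_s(t) is
   reduced to {0}; the frequency of that cluster is uniform in the center. *)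
Lemma unmatched_uniform N : (forall n, (N <= n)%N -> freq 0 n <= e) ->
  exists M : nat, forall c n, (M <= n)%N -> freq c n <= 2 * e.
Proof.
move=> center.
pose K := [set (0 : E)] `|` cball t s.
have cK : compact K by apply: compactU; [exact: compact_set1|exact: compact_cball].
have K0 : K 0 by left.
have unmE x : unmatched w s t x <-> recenter x w `&` K = [set 0].
  split => [[wx h]|h].
    apply/seteqP; split => [z [[y wy <-]] [//|]|_ ->].
      rewrite /cball /= (addrC (- x)) => hy; have := h y wy.
      by rewrite ltNge hy.
    by split => //; exists x => //; rewrite addNr.
  have [[y wy]] : (recenter x w `&` K) 0 by rewrite h.
  move=> /eqP; rewrite addrC subr_eq0 => /eqP yx _; rewrite yx in wy.
  split => // z wz; rewrite ltNge; apply/negP => zs.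
  have : (recenter x w `&` K) (z - x).
    by split; [exists z => //; rewrite addrC|right; rewrite /cball].
  rewrite h /= => z0; move: zs; rewrite z0 sub0r enormN => ts.
  by have := lt_le_trans st ts; rewrite ltxx.
have freqE c n : freq c n = (vol (cball (0 : E) n%:R))^-1 *
    (ncard [set x | cball c n%:R x /\ recenter x w `&` K = [set 0]])%:R.
  rewrite /freq; do 3 f_equal; apply/seteqP; split=> x [].
    by move=> /unmE.
  by move=> ? /unmE.
have [[y wy]|none] := pselect (exists2 y, w y & [set 0] = recenter y w `&` K); last first.
  exists 0%N => c n _; rewrite /freq (_ : _ `&` _ = set0).
    rewrite /ncard fset_set0 cardfs0 mulr0 mulr_ge0// ltW//.
  apply/seteqP; split => x // -[unmx _]; apply: none; exists x; first by case: unmx.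
  by symmetry; apply/unmE.
move=> yK; have [l lP] := ucf cK (ex_intro _ 0 erefl) (ex_intro2 _ _ y wy yK).
have {}lP (a : nat -> E) : freq (a n) n @[n --> \oo] --> l.
  by have := lP a; under eq_fun do rewrite -freqE.
have le : l <= e.
  have h := lP (fun=> 0).
  have := cvg_lim _ h => <- //.
  apply: limr_le; first by apply/cvg_ex; exists l.
  by near=> n; apply: center; near: n; exists N.
pose bad n c := 2 * e < freq c n.
pose a n := xget 0 (bad n).
have le2 : l < 2 * e by rewrite (le_lt_trans le)// ltr_pMl// ltr1n.
have [M _ MP] := cvgr_le _ (lP a) _ le2.
exists M => c n Mn; rewrite leNgt; apply/negP => badc.
have : bad n (a n) by apply: (@xgetI _ 0 (bad n) c).
by rewrite /bad ltNge; apply/negP/negPn; exact: MP.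
Unshelve. all: by end_near. Qed.

End uniform_unmatched.

(** * Patches are determined by few cells *)

Section differences.
Context {R : realType} {d : nat}.
Local Notation E := 'rV[R]_d.
Variables (w : set E) (r : R).
Hypotheses (r0 : 0 < r) (sw : separated r w) (wflc : flc w).

Lemma recenterP (x y : E) : recenter x w y <-> w (x + y).
Proof.
split=> [[z wz <-]|wxy]; first by rewrite addNKr.
by exists (x + y) => //; rewrite addKr.
Qed.

Lemma separated_recenter x : separated r (recenter x w).
Proof.
move=> a b /recenterP wa /recenterP wb ab; apply: (addrI x); apply: sw => //.
by rewrite opprD addrACA subrr add0r.
Qed.

Definition local_differences (c : nat) : set E :=
  [set a | enorm a <= c%:R /\ exists x, w x /\ w (x + a)].

Lemma finite_local_differences c : (0 < c)%N -> finite_set (local_differences c).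
Proof.
move=> c0; have fP : finite_set (patches w c%:R) by apply: wflc; rewrite ltr0n.
have : finite_set (\bigcup_(P in patches w c%:R) P).
  apply: bigcup_finite => // _ [x wx <-].
  exact: (separated_finite c r0 (@separated_recenter x)).
apply: sub_finite_set => a [ac [x [wx wxa]]].
exists (recenter x w `&` cball 0 c%:R); first by exists x.
by split; [exact/recenterP|rewrite /cball /= subr0].
Qed.

Lemma positive_lower_bound (A : seq R) :
  exists2 e : R, 0 < e & forall a, a \in A -> 0 < a -> e <= a.
Proof.
elim: A => [|a A [e e0 eA]]; first by exists 1.
have [a0|a0] := ltrP 0 a; last first.
  exists e => // b; rewrite inE => /orP[/eqP ->|/eA//].
  by move=> /lt_geF; rewrite a0.
exists (Num.min e a) => [|b]; first by rewrite lt_min e0.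
by rewrite inE ge_min => /orP[/eqP ->|/eA h /h ->//]; rewrite lexx orbT.
Qed.

Lemma local_differences_separated c : (0 < c)%N ->
  exists2 e : R, 0 < e & separated e (local_differences c).
Proof.
move=> c0; have fD := finite_local_differences c0.
have [e e0 he] := positive_lower_bound
  [seq enorm (a - b) | a <- fset_set (local_differences c), b <- fset_set (local_differences c)].
exists e => // a b Da Db ab; apply/eqP; rewrite -subr_eq0; apply/eqP/enorm_eq0.
apply/eqP; apply: contraTT ab => ab; rewrite -leNgt; apply: he.
  by apply/allpairsP; exists (a, b); rewrite !in_fset_set// !inE.
by rewrite lt_def ab enorm_ge0.
Qed.

End differences.


Section counting.

Lemma card_small_sets (R : realType) (X : finType) (M : nat) (lam : R) :
  0 < lam -> lam <= 1 ->
  #|[set A : {set X} | (#|A| <= M)%N]%SET|%:R * lam ^+ M <= (1 + lam) ^+ #|X|.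
Proof.
move=> lam0 lam1.
have -> : (1 + lam) ^+ #|X| = \sum_(A : {set X}) lam ^+ #|A|.
  rewrite -prodr_const; under eq_bigr do rewrite addrC.
  rewrite bigA_distr.
  apply: eq_bigr => A _; rewrite -prodr_const [RHS]big_mkcond/=.
  by apply: eq_bigr.
rewrite (bigID [in [set A : {set X} | (#|A| <= M)%N]%SET])/= -[leLHS]addr0 lerD//; last first.
  by apply: sumr_ge0 => A _; rewrite exprn_ge0// ltW.
rewrite mulr_natl -sumr_const; apply: ler_sum => A; rewrite inE => AM.
by rewrite ler_wiXn2l// ltW.
Qed.

Lemma ln_card_small_sets (R : realType) (X : finType) (M : nat) (lam : R) :
  0 < lam -> lam <= 1 ->
  ln (#|[set A : {set X} | (#|A| <= M)%N]%SET|%:R : R) <= #|X|%:R * lam + M%:R * - ln lam.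
Proof.
move=> lam0 lam1; have := card_small_sets X M lam0 lam1.
set N := #|_| => h.
have N0 : 0 < N%:R :> R.
  by rewrite ltr0n; apply/card_gt0P; exists finset.set0; rewrite inE cards0.
have l1 : 0 < 1 + lam by rewrite addr_gt0.
rewrite mulrN -lerBlDr opprK [M%:R * _]mulr_natl -lnXn// -lnM ?posrE ?exprn_gt0//.
apply: (@le_trans _ _ (ln ((1 + lam) ^+ #|X|))).
  by rewrite ler_ln ?posrE ?mulr_gt0 ?exprn_gt0.
rewrite lnXn// -[leLHS]mulr_natl ler_wpM2l// le_ln1Dx//.
by rewrite (lt_trans _ lam0)// ltrN10.
Qed.

Lemma ln_le_cube (R : realType) (a b : nat) : (a <= b ^ 3)%N ->
  ln (a%:R : R) <= 3 * ln b%:R.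
Proof.
have [->|b0] := posnP b; first by rewrite exp0n// leqn0 => /eqP ->; rewrite ln0// mulr0.
move=> ab; have [->|a0] := posnP a; first by rewrite ln0// mulr_ge0// ln_ge0// ler1n.
rewrite mulr_natl -lnXn ?ltr0n// -natrX.
by rewrite ler_ln ?posrE ?ltr0n ?expn_gt0 ?b0// ler_nat.
Qed.

Lemma card_interval (K a L : nat) (J : {set 'I_K}) :
  (forall k, k \in J -> (a <= k < a + L)%N) -> (#|J| <= L)%N.
Proof.
move=> h; rewrite cardE -(size_map val) -[leqRHS](size_iota a).
apply: uniq_leq_size; first by rewrite map_inj_uniq ?enum_uniq//; exact: val_inj.
by move=> _ /mapP[k + ->]; rewrite mem_enum mem_iota => /h.
Qed.

Lemma card_slab (d K : nat) (i0 : 'I_d) (J : {set 'I_K}) :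
  #|[set f : {ffun 'I_d -> 'I_K} | f i0 \in J]%SET| = (#|J| * K ^ d.-1)%N.
Proof.
pose F (i : 'I_d) : pred 'I_K := if i == i0 then [in J] else predT.
have -> : #|[set f : {ffun 'I_d -> 'I_K} | f i0 \in J]%SET| = #|family F|.
  apply: eq_card => f; rewrite inE; apply/idP/familyP => [h i|/(_ i0)].
    by rewrite /F; case: eqP => // ->.
  by rewrite /F eqxx.
rewrite card_family foldrE big_map big_enum/= (bigD1 i0)//= /F eqxx; congr (_ * _)%N.
rewrite (eq_bigr (fun=> K)); last by move=> i /negbTE ->; rewrite card_ord.
rewrite prod_nat_const; congr (_ ^ _)%N.
by rewrite -[in RHS](card_ord d) -(cardC1 i0); apply: eq_card.
Qed.

Lemma slab_bound (d m n q h : nat) : (0 < m)%N -> (0 < q)%N -> (q <= n)%N -> (0 < d)%N ->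
  h = ((m * n) %/ q)%N ->
  (q * ((2 * h + 3) * (m * n).*2.+1 ^ d.-1) <= 5 * (3 * (m * n)) ^ d)%N.
Proof.
move=> m0 q0 qn d0 ->; set N := (m * n)%N.
have qN : (q <= N)%N by rewrite (leq_trans qn)// leq_pmull.
have N0 : (0 < N)%N by exact: leq_trans qN.
rewrite mulnA -[in leqRHS](prednK d0) expnS mulnA leq_mul//.
  have := leq_trunc_div N q; rewrite mulnDr mulnCA (mulnC q).
  by move: (_ * q)%N => x xN; lia.
have N3 : (N.*2.+1 <= 3 * N)%N by rewrite -addnn; lia.
by case: (d.-1) => // e; rewrite leq_exp2r.
Qed.

End counting.

Section cell_sets.
Context {R : realType} {d : nat}.
Local Notation E := 'rV[R]_d.
Implicit Types (A W : set E).

Definition cellset (m n : nat) A : {set {ffun 'I_d -> 'I_((m * n).*2).+1}} :=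
  finset (fun c => `[< exists y, [/\ A y, cball (0 : E) n%:R y & cell m n y = c] >]).

Lemma cellsetP m n A c :
  reflect (exists y, [/\ A y, cball (0 : E) n%:R y & cell m n y = c]) (c \in cellset m n A).
Proof. by rewrite finset.inE; exact: asboolP. Qed.

Lemma card_cellset m n A : finite_set (A `&` cball 0 n%:R) ->
  (#|cellset m n A| <= ncard (A `&` cball (0 : E) n%:R))%N.
Proof.
move=> fA.
rewrite /ncard -(size_map (cell m n)); apply: leq_trans (card_size _).
apply/subset_leq_card/fintype.subsetP => c /cellsetP[y [Ay yn <-]].
by apply/mapP; exists y => //; rewrite in_fset_set// inE.
Qed.

Lemma card_cellset_slab m n q (i0 : 'I_d) A : (0 < q)%N ->
  (forall x, A x -> q%:R * `|x ord0 i0| <= n%:R) ->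
  (#|cellset m n A| <= (2 * ((m * n) %/ q) + 3) * (m * n).*2.+1 ^ d.-1)%N.
Proof.
move=> q0 Aq; set h := ((m * n) %/ q)%N.
pose J : {set 'I_((m * n).*2).+1} :=
  finset (fun k : 'I_((m * n).*2).+1 => (m * n <= k + h.+1)%N && (k <= m * n + h.+1)%N).
have cJ : (#|J| <= 2 * h + 3)%N.
  apply: (@card_interval _ (m * n - h.+1)) => k; rewrite finset.inE => /andP[h1 h2].
  by apply/andP; split; lia.
apply: (@leq_trans (#|J| * (m * n).*2.+1 ^ d.-1)); last by rewrite leq_mul2r cJ orbT.
rewrite -(card_slab i0); apply/subset_leq_card/fintype.subsetP => c /cellsetP[x [Ax xn <-]].
have /andP[] := cell_coord m i0 xn; rewrite !finset.inE.
set k := (cell m n x i0 : nat) => k1 k2.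
have qx := Aq x Ax.
have qmx : q%:R * `|m%:R * x ord0 i0| <= (m * n)%:R.
  by rewrite normrM ger0_norm// mulrCA natrM ler_wpM2l.
have := ler_norm (m%:R * x ord0 i0); have := ler_norm (- (m%:R * x ord0 i0)).
rewrite normrN => x1 x2; have q0R : 0 < q%:R :> R by rewrite ltr0n.
have hq a : (q * a <= m * n)%N -> (a <= h)%N by move=> qa; rewrite leq_divRL// mulnC.
have natk1 : (q * (k - m * n) <= m * n)%N.
  have [kmn|/ltnW kmn] := leqP k (m * n); first by rewrite (eqP (_ : k - m * n == 0))%N// muln0.
  rewrite -(ler_nat R) natrM natrB// (le_trans _ qmx)// ler_pM2l//.
  by rewrite lerBlDr (le_trans k1)// lerD2r.
have natk2 : (q * (m * n - k.+1) <= m * n)%N.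
  have [kmn|/ltnW kmn] := leqP (m * n) k.+1.
    by rewrite (eqP (_ : m * n - k.+1 == 0))%N// muln0.
  rewrite -(ler_nat R) natrM natrB// (le_trans _ qmx)// ler_pM2l//.
  by rewrite lerBlDr -lerBlDl (le_trans _ (ltW k2))//; lra.
have := hq _ natk1; have := hq _ natk2.
by move=> a1 a2; apply/andP; split; lia.
Qed.

Lemma cellset_eq m n A A' : cellset m n A = cellset m n A' ->
  forall x, A x -> cball (0 : E) n%:R x ->
  exists x', [/\ A' x', cball (0 : E) n%:R x' & cell m n x = cell m n x'].
Proof.
move=> AA' x Ax xn; have : cell m n x \in cellset m n A by apply/cellsetP; exists x.
by rewrite AA' => /cellsetP[x' [? ? ?]]; exists x'.
Qed.

Lemma ncard_unmatched_recenter W s (t x : E) n :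
  finite_set (unmatched W s t `&` cball x n%:R) ->
  (ncard (unmatched (recenter x W) s t `&` cball 0 n%:R) <=
   ncard (unmatched W s t `&` cball x n%:R))%N.
Proof.
move=> fU.
have UE : unmatched (recenter x W) s t `&` cball 0 n%:R `<=`
    (fun z => - x + z) @` (unmatched W s t `&` cball x n%:R).
  move=> y [[/recenterP Wy h] yn]; exists (x + y); last by rewrite addKr.
  split; last by rewrite /cball /= addrAC subrr add0r -[y]subr0.
  split => // z Wz; have /h : recenter x W (z - x) by apply/recenterP; rewrite addrC subrK.
  by rewrite opprD addrA.
apply: (leq_trans (ncard_le _ UE)); first exact: finite_image.
rewrite /ncard fset_set_image//; exact: leq_imfset_card.
Qed.

End cell_sets.

Section determinism.
Context {R : realType} {d : nat}.
Local Notation E := 'rV[R]_d.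
Variables (w S : set E) (r rho s sigma : R) (m n c : nat) (t : E).
Hypotheses (r0 : 0 < r) (sw : separated r w) (rho0 : 0 <= rho).
Hypothesis w_dense : forall x : E, w `&` cball x rho !=set0.
Hypotheses (c_large : 2 * rho + 2 <= c%:R) (m0 : (0 < m)%N).
Hypotheses (mr : d%:R / m%:R < r) (ms : d%:R / m%:R < sigma) (m1 : d%:R / m%:R <= 1 :> R).
Hypotheses (ss : 2 * s < sigma) (s1 : 2 * s <= 1).
Hypothesis w_diff : separated sigma (local_differences w c).

Definition signed (b : bool) : E := if b then t else - t.

Hypothesis t_closer : forall x : E, enorm x <= n%:R -> ~ S x ->
  exists b, enorm (x - signed b) + s + 1 <= enorm x.

Definition part (W : set E) (o : option bool) : set E :=
  if o is Some b then unmatched W s (signed b) else W `&` S.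

Definition code_le (W W' : set E) := forall o x, part W o x -> cball 0 n%:R x ->
  exists x', [/\ part W' o x', cball 0 n%:R x' & cell m n x = cell m n x'].

Let step (W W' : set E) k :
  (exists x, w x /\ W = recenter x w) -> (exists x, w x /\ W' = recenter x w) ->
  code_le W W' -> code_le W' W ->
  (forall x : E, enorm x <= k%:R -> enorm x <= n%:R -> (W x <-> W' x)) ->
  forall x, enorm x <= k.+1%:R -> enorm x <= n%:R -> W x -> W' x.
Proof.
have := (rho0, c_large, s1, ss) => -[[[rho0' c_large'] s1'] ss'].
move=> [x1 [wx1 WE]] [x2 [wx2 WE']] WW' W'W IH x xk xn Wx.
have sW : separated r W by rewrite WE; exact: separated_recenter.
have W0 : W 0 by rewrite WE; apply/recenterP; rewrite addr0.
have W'0 : W' 0 by rewrite WE'; apply/recenterP; rewrite addr0.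
have {}IH y : enorm y <= enorm x - 1 -> W y <-> W' y.
  move=> yx; apply: IH; last by rewrite (le_trans yx)// lerBlDr (le_trans xn)// lerDl.
  by rewrite (le_trans yx)// lerBlDr natr1.
(* a neighbour of x closer to the origin, hence already known to be common *)
have [z [Wz W'z xz]] : exists z, [/\ W z, W' z & enorm (x - z) <= 2 * rho + 1].
  have [xr|xr] := lerP (enorm x) (rho + 1).
    by exists 0; split => //; rewrite subr0; lra.
  have x0 : 0 < enorm x by lra.
  pose x' := (1 - (rho + 1) / enorm x) *: x.
  have xx' : enorm (x - x') = rho + 1.
    rewrite /x' scalerBl scale1r opprB addrC subrK enormZ ger0_norm ?divfK ?gt_eqF//.
    by rewrite divr_ge0; lra.
  have x'E : enorm x' = enorm x - (rho + 1).
    rewrite /x' enormZ ger0_norm ?mulrBl ?mul1r ?divfK ?gt_eqF//.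
    by rewrite subr_ge0 ler_pdivrMr// mul1r ltW.
  have [u [wu ux']] := w_dense (x1 + x').
  have Wz : W (u - x1) by rewrite WE; apply/recenterP; rewrite addrC subrK.
  have zx' : enorm (u - x1 - x') <= rho by rewrite -addrA -opprD.
  exists (u - x1); split => //.
    apply/IH => //; rewrite -(subrK x' (u - x1)) (le_trans (ler_enormD _ _))//.
    by rewrite x'E; lra.
  rewrite (le_trans (ler_enorm_dist x' _ _))// xx' enormB; lra.
have W'diff y : W' y -> enorm (y - z) <= c%:R -> local_differences w c (y - z).
  rewrite WE' => /recenterP wy yz; split => //; exists (x2 + z); split.
    by apply/recenterP; rewrite -WE'.
  by rewrite addrACA subrr addr0.
have Wdiff y : W y -> enorm (y - z) <= c%:R -> local_differences w c (y - z).
  rewrite WE => /recenterP wy yz; split => //; exists (x1 + z); split.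
    by apply/recenterP; rewrite -WE.
  by rewrite addrACA subrr addr0.
(* differences with z are sigma-separated, so a point of W' near x must be x *)
suff [x' [W'x' xx' xx1]] : exists x', [/\ W' x', enorm (x - x') < sigma & enorm (x - x') <= 1].
  suff -> : x = x' by [].
  apply: (addIr (- z)); apply: w_diff.
  - by apply: Wdiff => //; rewrite (le_trans xz)//; lra.
  - apply: W'diff => //; rewrite (le_trans (ler_enorm_dist x _ _))// enormB; lra.
  - by rewrite opprB addrA subrK.
have coded o : part W o x -> exists x', [/\ W' x', enorm (x - x') < sigma & enorm (x - x') <= 1].
  move=> px; have xb : cball 0 n%:R x by rewrite /cball /= subr0.
  have [x' [px' x'n cxx']] := WW' o x px xb.
  have close := cell_close m0 xb x'n cxx'; exists x'; split.
  - by case: o px' {px} => [b|] [].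
  - exact: le_lt_trans ms.
  - exact: le_trans m1.
have [Sx|nSx] := pselect (S x); first by apply: (coded None).
(* Outside of S, either x itself is coded, or it is matched with a point y closer
   to the origin, and then the code shows that y is matched in W' too. *)
have [b xb] := t_closer xn nSx.
have negb : signed (~~ b) = - signed b by case: (b); rewrite /= ?opprK.
have [ux|] := pselect (unmatched W s (signed (~~ b)) x); first exact: (coded (Some (~~ b))).
move=> /not_andP[//|/existsNP[y /not_implyP[Wy /negP]]].
rewrite -leNgt negb opprK => yx.
have yxn : enorm y <= enorm x - 1.
  have -> : y = (y - x + signed b) + (x - signed b).
    by rewrite addrA addrAC addrK subrK.
  by rewrite (le_trans (ler_enormD _ _))//; lra.
have W'y : W' y by apply/IH.
have [uy|] := pselect (unmatched W' s (signed b) y).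
  have yb : cball (0 : E) n%:R y by rewrite /cball /= subr0; lra.
  have [y' [uy' y'n cyy']] := W'W (Some b) y uy yb.
  have e : y = y'.
    apply: (cell_inj m0 mr sW) cyy'; rewrite inE; split => //; exact: (proj1 uy').
  move: uy'; rewrite -e => -[_ /(_ x Wx)].
  have -> : x - y - signed b = - (y - x + signed b) by rewrite opprD opprB.
  by rewrite enormN ltNge yx.
move=> /not_andP[//|/existsNP[x' /not_implyP[W'x' /negP]]].
rewrite -leNgt => x'y; exists x'.
have : enorm (x - x') <= 2 * s.
  have -> : x - x' = - ((x' - y - signed b) + (y - x + signed b)).
    by rewrite addrACA addNr addr0 addrA subrK opprB.
  by rewrite enormN (le_trans (ler_enormD _ _))//; lra.
by move=> h; split => //; lra.
Qed.

Lemma code_determines (W W' : set E) :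
  (exists x, w x /\ W = recenter x w) -> (exists x, w x /\ W' = recenter x w) ->
  code_le W W' -> code_le W' W ->
  W `&` cball 0 n%:R = W' `&` cball 0 n%:R.
Proof.
move=> HW HW' WW' W'W.
have H k x : enorm x <= k%:R -> enorm x <= n%:R -> (W x <-> W' x).
  elim: k x => [|k IH] x xk xn.
    have /enorm_eq0 -> : enorm x = 0 by apply/eqP; rewrite eq_le xk enorm_ge0.
    have [[x1 [wx1 ->]] [x2 [wx2 ->]]] := (HW, HW').
    by split => _; apply/recenterP; rewrite addr0.
  have IH' (y : E) : enorm y <= k%:R -> enorm y <= n%:R -> (W' y <-> W y).
    by move=> yk yn; apply: iff_sym; exact: IH.
  by split; [exact: (step HW HW' WW' W'W (@IH))|exact: (step HW' HW W'W WW' IH')].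
apply/seteqP; split => x [Wx]; rewrite {1}/cball /= subr0 => xn; split => //.
- exact/(H _ _ xn xn).
- by rewrite /cball /= subr0.
- exact/(H _ _ xn xn).
- by rewrite /cball /= subr0.
Qed.

Lemma ncard_patches_le (M : nat) : finite_set (patches w n%:R) ->
  (forall x, w x -> forall o, (#|cellset m n (part (recenter x w) o)| <= M)%N) ->
  (ncard (patches w n%:R) <=
   #|[set A : {set {ffun 'I_d -> 'I_((m * n).*2).+1}} | (#|A| <= M)%N]%SET| ^ 3)%N.
Proof.
move=> fP HM; set X := finset _.
pose codes x := let C o := cellset m n (part (recenter x w) o) in
  (C None, C (Some true), C (Some false)).
pose center P := xget 0 [set x | w x /\ P = recenter x w `&` cball 0 n%:R].
have centerP P : patches w n%:R P ->
    w (center P) /\ P = recenter (center P) w `&` cball 0 n%:R.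
  move=> [x wx xP].
  pose Q := [set x | w x /\ P = recenter x w `&` cball 0 n%:R].
  exact: (@xgetI _ 0 Q x (conj wx (esym xP))).
have codes_inj x x' : w x -> w x' -> codes x = codes x' ->
    recenter x w `&` cball 0 n%:R = recenter x' w `&` cball 0 n%:R.
  move=> wx wx' [e0 e1 e2]; apply: code_determines; [by exists x|by exists x'|..].
    by move=> [[|]|]; apply: cellset_eq.
  by move=> [[|]|]; apply: cellset_eq.
rewrite /ncard -(size_map (codes \o center)).
have -> : (#|X| ^ 3)%N = #|finset.setX (finset.setX X X) X| by rewrite !cardsX !expnS expn0 muln1 mulnA.
rewrite cardE; apply: uniq_leq_size.
  rewrite map_inj_in_uniq ?fset_uniq// => P P'; rewrite !in_fset_set// !inE.
  move=> /centerP[wP PE] /centerP[wP' PE'] /codes_inj e.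
  by rewrite PE PE'; exact: e.
move=> _ /mapP[P + ->]; rewrite in_fset_set// inE => /centerP[wP _].
rewrite mem_enum /codes /= !finset.in_setX /= /X !finset.inE.
by rewrite (HM _ wP None) (HM _ wP (Some true)) (HM _ wP (Some false)).
Qed.

End determinism.

(** * The entropy bound *)

Section entropy_bound.
Context {R : realType} {d : nat}.
Local Notation E := 'rV[R]_d.

Lemma dotp_delta (x : E) i : dotp x (delta_mx 0 i) = x ord0 i.
Proof.
rewrite /dotp (bigD1 i)//= big1 ?addr0 => [|j ji]; first by rewrite mxE !eqxx mulr1.
by rewrite mxE (negbTE ji) andbF mulr0.
Qed.

Lemma enorm_delta i : enorm (delta_mx 0 i : E) = 1.
Proof. by rewrite /enorm dotp_delta mxE !eqxx sqrtr1. Qed.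

(* With t = +- tau e_i of the right sign, |x - t|^2 = |x|^2 - 2 tau |x_i| + tau^2. *)
Lemma slab_closer (i : 'I_d) (tau q s N : R) (x : E) :
  1 <= q -> 0 <= s -> 2 * q * (s + 1) <= tau -> q * tau <= N ->
  enorm x <= N -> N < q * `|x ord0 i| ->
  exists b, enorm (x - signed (tau *: delta_mx 0 i) b) + s + 1 <= enorm x.
Proof.
move=> q1 s0 htau hN xN hx.
have tau0 : 0 <= tau by nra.
have [b hb] : exists b, dotp x (signed (tau *: delta_mx 0 i) b) = tau * `|x ord0 i|.
  have [x0|x0] := lerP 0 (x ord0 i).
    by exists true; rewrite /= dotpZr dotp_delta ger0_norm.
  by exists false; rewrite /= dotpNr dotpZr dotp_delta ltr0_norm// mulrN.
have hbb : dotp (signed (tau *: delta_mx 0 i) b) (signed (tau *: delta_mx 0 i) b) = tau ^+ 2.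
  case: (b); rewrite /= ?dotpNl ?dotpNr ?opprK -sqr_enorm enormZ enorm_delta mulr1;
    by rewrite real_normK ?num_real.
exists b; move: (signed _ b) hb hbb => T hb hbb; set y := x - T.
have yy : enorm y ^+ 2 = enorm x ^+ 2 - 2 * (tau * `|x ord0 i|) + tau ^+ 2.
  rewrite !sqr_enorm /y dotpDl !dotpDr !dotpNl !dotpNr opprK hbb (dotpC T x) hb.
  by ring.
have xi := coord_le_enorm x i.
move: yy xi hx xN; move: (enorm_ge0 y) (enorm_ge0 x).
move: (enorm x) (enorm y) `|x ord0 i| => X Y Z Y0 X0 yy xi hx xN.
have Xs : s + 1 <= X by nra.
rewrite -addrA -lerBrDr -(@ler_pXn2r _ 2)// ?nnegrE ?subr_ge0//.
rewrite yy -subr_ge0; have q0 : 0 < q by exact: lt_le_trans q1.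
rewrite -(pmulr_rge0 _ q0); nra.
Qed.

Lemma powern_le_vol (n : nat) :
  n%:R ^+ d <= (d.+1%:R / 2) ^+ d * vol (cball (0 : E) n%:R).
Proof.
have d1 : 0 < d.+1%:R :> R by rewrite ltr0n.
apply: (@le_trans _ _ ((d.+1%:R / 2) ^+ d * (2 * (n%:R / d.+1%:R)) ^+ d)).
  rewrite -exprMn; have -> // : d.+1%:R / 2 * (2 * (n%:R / d.+1%:R)) = n%:R :> R.
  by field; rewrite ?pnatr_eq0.
by rewrite ler_wpM2l ?exprn_ge0 ?divr_ge0// vol_cball_ge.
Qed.

Variables (w : set E) (r rho : R).
Hypotheses (d0 : (0 < d)%N) (r0 : 0 < r) (r_rho : r <= rho) (w_del : delone r rho w).
Hypotheses (w_flc : flc w) (w_ucf : uniform_cluster_frequencies w).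
Hypothesis w_pp : pure_point_diffractive w.

Let G (m : nat) : R := (3 * m%:R) ^+ d * (d.+1%:R / 2) ^+ d.

Let cells_le_vol (m n : nat) :
  ((3 * (m * n)) ^ d)%:R <= G m * vol (cball (0 : E) n%:R) :> R.
Proof.
rewrite natrX natrM natrM mulrA exprMn /G -mulrA ler_wpM2l ?exprn_ge0 ?mulr_ge0//.
exact: powern_le_vol.
Qed.

Lemma patches_coded : exists2 m : nat, (0 < m)%N &
  forall (q : nat) (e : R), (0 < q)%N -> 0 < e ->
  exists N : nat, forall n, (N <= n)%N -> exists M : nat,
    (ncard (patches w n%:R) <=
     #|[set A : {set {ffun 'I_d -> 'I_((m * n).*2).+1}} | (#|A| <= M)%N]%SET| ^ 3)%N /\
    M%:R <= (5 * G m / q%:R + 2 * e) * vol (cball (0 : E) n%:R).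
Proof.
have le4 (a b c e n : nat) : (a + b + c + e <= n)%N ->
    [/\ (a <= n)%N, (b <= n)%N, (c <= n)%N & (e <= n)%N].
  by move=> ?; split; lia.
have le3 (a b : R) : 1 <= a -> 2 * b <= 1 -> 2 * a * (b + 1) <= 3 * a by nra.
have sw : separated r w := delone_separated r0 w_del.
have rho0 : 0 <= rho by rewrite (le_trans (ltW r0)).
pose c := (Num.truncn (2 * rho + 2)).+1.
have c_large : 2 * rho + 2 <= c%:R by exact/ltW/truncnS_gt.
have [sigma sigma0 w_diff] : exists2 e, 0 < e & separated e (local_differences w c).
  exact: (@local_differences_separated _ _ _ r).
pose delta := Num.min (Num.min r sigma) 1.
have delta0 : 0 < delta by rewrite !lt_min r0 sigma0 ltr01.
have [m m0 md] := @exists_mesh R d _ delta0.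
have := md; rewrite !lt_min => /andP[/andP[mr ms] /ltW m1].
exists m => // q e q0 e0.
pose s := 2 * (delta / 8).
have s0 : 0 < delta / 8 by rewrite divr_gt0.
have dr : delta <= r by rewrite !ge_min lexx.
have dsigma : delta <= sigma by rewrite !ge_min lexx orbT.
have d1 : delta <= 1 by rewrite !ge_min lexx orbT.
have sr : 4 * (delta / 8) < r by lra.
have ss : 2 * s < sigma by rewrite /s; lra.
have s1 : 2 * s <= 1 by rewrite /s; lra.
have s_gt0 : 0 < s by rewrite mulr_gt0.
pose i0 : 'I_d := Ordinal d0.
pose v : E := (3 * q%:R) *: delta_mx 0 i0.
have [p p0 [N0 HN0]] := @almost_period_center_each R d w r (delta / 8) e v s0 sr sw e0 w_pp.
pose tau : R := p%:R * (3 * q%:R).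
have tE : p%:R *: v = tau *: delta_mx 0 i0 by rewrite scalerA.
pose t : E := tau *: delta_mx 0 i0.
have q1 : 1 <= q%:R :> R by rewrite ler1n.
have p1 : 1 <= p%:R :> R by rewrite ler1n.
have tau3 : 3 * q%:R <= tau by rewrite ler_peMl// mulr_ge0.
have st b : s < enorm (signed t b).
  have -> : enorm (signed t b) = tau.
    by case: b; rewrite /= ?enormN enormZ enorm_delta mulr1 ger0_norm//; lra.
  by lra.
have unif b : exists M : nat, forall c n, (M <= n)%N ->
    (vol (cball (0 : E) n%:R))^-1 *
      (ncard (unmatched w s (signed t b) `&` cball c n%:R))%:R <= 2 * e.
  apply: (unmatched_uniform w_ucf e0 (st b) (N := N0)) => n Nn.
  by apply: HN0 => //; rewrite tE; case: b; [left|right].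
have [M1 HM1] := unif true; have [M2 HM2] := unif false.
pose N3 := (Num.truncn (q%:R * tau)).+1.
exists (N3 + q + M1 + M2)%N => n Nn.
have [N3n qn M1n M2n] := le4 _ _ _ _ _ Nn.
have n0 : (0 < n)%N by exact: leq_trans qn.
have taun : q%:R * tau <= n%:R.
  by rewrite (le_trans (ltW (truncnS_gt _)))// ler_nat.
pose S : set E := [set x | q%:R * `|x ord0 i0| <= n%:R].
pose h := ((m * n) %/ q)%N.
pose Mslab := ((2 * h + 3) * (m * n).*2.+1 ^ d.-1)%N.
pose V := vol (cball (0 : E) n%:R).
have V0 : 0 <= V by exact: vol_cball_ge0.
pose U := Num.truncn (2 * e * V).
have U0 : 0 <= 2 * e * V by rewrite !mulr_ge0// ltW.
have fin x b : finite_set (unmatched w s (signed t b) `&` cball x n%:R).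
  have fN := separated_finite (Num.truncn (n%:R + enorm x)).+1 r0 sw.
  apply: sub_finite_set fN => y [[wy _]]; rewrite /cball /= => yx; split => //.
  rewrite /cball /= subr0 -(subrK x y) (le_trans (ler_enormD _ _))//.
  by rewrite (le_trans _ (ltW (truncnS_gt _)))// lerD2r.
exists (Mslab + U)%N; split; last first.
  rewrite natrD mulrDl lerD ?truncn_le//.
  rewrite mulrAC ler_pdivlMr ?ltr0n// mulrC -mulrA.
  apply: (@le_trans _ _ (5 * ((3 * (m * n)) ^ d)%:R)); last by rewrite ler_wpM2l ?cells_le_vol.
  by rewrite -!natrM ler_nat slab_bound.
apply: (@ncard_patches_le _ _ w S r rho s sigma m n c t) => //.
- by move=> x; case: w_del => _ /(_ x).
- move=> x xn /negP; rewrite -ltNge => hx.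
  apply: (@slab_closer _ _ q%:R _ n%:R) => //; first exact: ltW.
  exact: le_trans (le3 _ _ q1 s1) tau3.
- by apply: w_flc; rewrite ltr0n.
move=> x wx [b|]; last first.
  apply: (@leq_trans Mslab); last exact: leq_addr.
  by apply: (@card_cellset_slab _ _ m n q i0) => // y [].
apply: (@leq_trans U); last exact: leq_addl.
have Vgt0 : 0 < V.
  rewrite -(pmulr_rgt0 _ (_ : 0 < (d.+1%:R / 2) ^+ d)) ?exprn_gt0 ?divr_gt0//.
  by rewrite (lt_le_trans _ (powern_le_vol n))// exprn_gt0// ltr0n.
have freq : (ncard (unmatched w s (signed t b) `&` cball x n%:R))%:R <= 2 * e * V.
  rewrite mulrC -ler_pdivrMl//.
  by case: b => /=; [exact: HM1|exact: HM2].
rewrite truncn_ge_nat//; apply: le_trans freq; rewrite ler_nat.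
apply: leq_trans (ncard_unmatched_recenter (@fin x b)).
apply: card_cellset.
have fx := separated_finite n r0 (separated_recenter sw (x := x)).
by apply: sub_finite_set fx => y [[wy _] yn].
Qed.

Lemma entropy_eventually_le (eps : R) : 0 < eps ->
  exists N : nat, forall n, (N <= n)%N ->
    (vol (cball (0 : E) n%:R))^-1 * ln (ncard (patches w n%:R))%:R <= eps.
Proof.
move=> eps0; have [m m0 Hm] := patches_coded.
have le3 a : (0 < a)%N -> (a.*2.+1 <= 3 * a)%N by rewrite -addnn => ?; lia.
have G0 : 0 <= G m by rewrite mulr_ge0// exprn_ge0 ?divr_ge0// mulr_ge0.
pose lam := Num.min 1 (eps / (9 * (G m + 1))).
have lam0 : 0 < lam by rewrite lt_min ltr01 divr_gt0// mulr_gt0// ltr_wpDl.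
have lam1 : lam <= 1 by rewrite ge_min lexx.
have Glam : 9 * (G m * lam) <= eps.
  apply: (@le_trans _ _ (9 * ((G m + 1) * (eps / (9 * (G m + 1)))))).
    apply: ler_wpM2l => //; apply: ler_pM => //; first exact: ltW.
      by rewrite lerDl.
    by rewrite ge_min lexx orbT.
  have G1 : G m + 1 != 0 by rewrite gt_eqF// ltr_wpDl.
  by rewrite le_eqVlt; apply/orP; left; apply/eqP; field.
pose L := - ln lam; have L0 : 0 <= L by rewrite oppr_ge0 ln_le0.
pose q := (Num.truncn (45 * G m * L / eps)).+1.
have q0 : 0 < q%:R :> R by rewrite ltr0n.
have Gq : 9 * (5 * G m / q%:R * L) <= eps.
  have : 45 * G m * L / eps < q%:R := truncnS_gt _.
  rewrite ltr_pdivrMr// => /ltW h.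
  have -> : 9 * (5 * G m / q%:R * L) = 45 * G m * L / q%:R by field; rewrite gt_eqF.
  by rewrite ler_pdivrMr// [leRHS]mulrC.
pose e := eps / (18 * (L + 1)).
have e0 : 0 < e by rewrite divr_gt0// mulr_gt0// ltr_wpDl.
have eL : 9 * (2 * e * L) <= eps.
  apply: (@le_trans _ _ (9 * (2 * e * (L + 1)))).
    by rewrite ler_wpM2l// ler_wpM2l ?lerDl// mulr_ge0// ltW.
  have L1 : L + 1 != 0 by rewrite gt_eqF// ltr_wpDl.
  by rewrite le_eqVlt; apply/orP; left; apply/eqP; rewrite /e; field.
have [N HN] := Hm q e (ltn0Sn _) e0; exists N.+1 => n Nn.
have [M [cardM MV]] := HN n (ltnW Nn).
have lnX := ln_card_small_sets {ffun 'I_d -> 'I_((m * n).*2).+1} M lam0 lam1.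
move: (#|finset _|) cardM lnX => X cardM lnX.
set V := vol _ in MV *.
have V0 : 0 <= V by exact: vol_cball_ge0.
have {}lnX : ln X%:R <= G m * V * lam + M%:R * L.
  rewrite (le_trans lnX)// lerD2r ler_wpM2r ?(ltW lam0)//.
  rewrite card_ffun !card_ord; apply: le_trans (cells_le_vol m n); rewrite ler_nat.
  have mn0 : (0 < m * n)%N by rewrite muln_gt0 m0 (leq_trans _ Nn).
  by rewrite leq_exp2r// le3.
have lnP := ln_le_cube R cardM.
have [->|Vn0] := eqVneq V 0; first by rewrite invr0 mul0r ltW.
have {Vn0} Vgt0 : 0 < V by rewrite lt_def Vn0.
rewrite ler_pdivrMl// mulrC (le_trans lnP)//.
have ML : M%:R * L <= (5 * G m / q%:R + 2 * e) * V * L by rewrite ler_wpM2r.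
have : 9 * ((G m * lam) + (5 * G m / q%:R * L) + (2 * e * L)) <= 3 * eps by lra.
move: (5 * G m / q%:R) (2 * e) ML lnX => a b ML lnX h.
apply: (@le_trans _ _ (3 * (V * (G m * lam + a * L + b * L)))).
  by rewrite ler_wpM2l// (le_trans lnX)//; lra.
by rewrite mulrCA [leRHS]mulrC ler_wpM2l//; lra.
Qed.

End entropy_bound.

Theorem theorem5 (R : realType) (d : nat) (r rho : R) (w : set 'rV[R]_d)
    (hd : (1 <= d)%N) (hr : 0 < r) (hrho : r <= rho)
    (hdelone : delone r rho w) (hflc : flc w)
    (hucf : uniform_cluster_frequencies w)
    (hpp : pure_point_diffractive w) :
  patch_counting_entropy w = 0%E.
Proof.
have bound := entropy_eventually_le hd hr hrho hdelone hflc hucf hpp.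
have cvg0 : (vol (cball (0 : 'rV[R]_d) n%:R))^-1 * ln (ncard (patches w n%:R))%:R
    @[n --> \oo] --> (0 : R).
  apply/cvgrPdist_le => e e0; have [N HN] := bound e e0.
  exists N => // n /HN h; rewrite sub0r normrN ger0_norm//.
  rewrite mulr_ge0 ?invr_ge0 ?vol_cball_ge0//.
  have [->|P0] := posnP (ncard (patches w n%:R)); first by rewrite ln0.
  by rewrite ln_ge0// ler1n.
have cvgE : ((vol (cball (0 : 'rV[R]_d) n%:R))^-1 *
    ln (ncard (patches w n%:R))%:R)%:E @[n --> \oo] --> 0%E.
  by apply: cvg_EFin => //; exact: nearW.
by rewrite /patch_counting_entropy; have [_ ->] := cvg_limn_einf_sup cvgE.
Qed.
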